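(* Let $p$ be a prime, $N\in\mathbb Z$, $\alpha>0$, and let $\Phi:\mathbb R\to\mathbb R$ be a strictly monotone increasing continuous function with $\Phi(0)=0$. Let $1\le\gamma\le\infty$, let $u_0\in L^\gamma(B_N)$ with $u_0>0$, and let $u(t,x)$, $t>0$, $x\in B_N$, be the mild solution in $L^1(B_N)$ of the Cauchy problem $$\frac{\partial u}{\partial t}+D^\alpha_N(\Phi(u))=0,\qquad u(0,x)=u_0(x).$$ Then $u(t,\cdot)\in L^\gamma(B_N)$ and $$\|u(t,\cdot)\|_{L^\gamma(B_N)}\le\|u_0\|_{L^\gamma(B_N)}\qquad\text{for all } t>0.$$
   Context: $\mathbb Q_p$ is the field of $p$-adic numbers with absolute value $|\cdot|_p$, and $dx$ is the Haar measure on its additive group with $\int_{\mathbb Z_p}dx=1$. $\chi(x)=\exp(2\pi i\{x\}_p)$, with $\{x\}_p$ the $p$-adic fractional part, is the standard additive character of $\mathbb Q_p$. $B_N=\{x\in\mathbb Q_p:\ |x|_p\le p^N\}$, and $L^\gamma(B_N)$ (real-valued functions) is taken with respect to $dx$; since $B_N$ has finite measure, $L^\gamma(B_N)\subset L^1(B_N)$. $\lambda=\dfrac{p-1}{p^{\alpha+1}-1}\,p^{\alpha(1-N)}$. For $t>0$ let $Z(t,x)=\int_{\mathbb Q_p}\chi(\xi x)e^{-t|\xi|_p^\alpha}\,d\xi$, $x\in\mathbb Q_p$, and, for $x\in B_N$, $$Z_N(t,x)=e^{\lambda t}Z(t,x)+c(t),\qquad c(t)=p^{-N}-p^{-N}(1-p^{-1})e^{\lambda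 t}\sum_{n=0}^\infty\frac{(-1)^n}{n!}t^n\frac{p^{-N\alpha n}}{1-p^{-\alpha n-1}}.$$ It is known that the operators $(T_N(t)u)(x)=\int_{B_N}Z_N(t,x-y)u(y)\,dy$, $t>0$, with $T_N(0)=I$, form a strongly continuous contraction semigroup on $L^1(B_N)$. $A_N$ denotes its generator with the sign convention $T_N(t)=e^{-tA_N}$ (so $-A_N$ is the infinitesimal generator in the usual convention). In the nonlinear equation, $D^\alpha_N$ denotes the operator $A_N+\lambda I$ on $L^1(B_N)$. (On locally constant functions $\varphi$ on $B_N$ it acts as $(D^\alpha_N\varphi)(x)=\lambda\varphi(x)+\frac{1-p^\alpha}{1-p^{-\alpha-1}}\int_{B_N}|y|_p^{-\alpha-1}[\varphi(x-y)-\varphi(x)]\,dy$.) The nonlinear operator $D^\alpha_N\circ\Phi$ on $L^1(B_N)$, $u\mapsto D^\alpha_N(\Phi(u))$ with domain $\{u\in L^1(B_N):\Phi(u)\in\operatorname{Dom}A_N\}$, is $m$-accretive by known results of Crandall–Pierre and Brézis–Strauss, so for each $u_0\in L^1(B_N)$ the Cauchy problem has a unique mild solution. It is given by the Crandall–Liggett exponential formula $$u(t,\cdot)=\lim_{k\to\infty}\left(I+\frac tk\,D^\alpha_N\circ\Phi\right)^{-k}u_0\quad\text{in }L^1(B_N),\ t>0,$$ and the maps $u_0\mapsto u(t,\cdot)$ form a nonlinear contraction semigroup on $L^1(B_N)$. Inequalities between functions are understood almost everywhere. *)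

(* Defs.v *)
From HB Require Import structures.
From mathcomp Require Import all_boot all_order all_algebra generic_quotient ring_quotient.
From mathcomp Require Import all_classical all_reals all_analysis.
From mathcomp Require Import complex.
From mathcomp Require Import ring zify.
Set Implicit Arguments.
Unset Strict Implicit.
Unset Printing Implicit Defensive.
Import Order.TTheory GRing.Theory Num.Theory.
Import numFieldNormedType.Exports.
Local Open Scope classical_set_scope.
Local Open Scope ring_scope.
Local Open Scope quotient_scope.

(* Q_p is built as the completion of Q for the p-adic absolute value: Cauchy
   sequences of rationals modulo the null sequences. *)

Definition padic_val (p : nat) (q : rat) : int :=
  (logn p `|numq q|)%:Z - (logn p `|denq q|)%:Z.

Definition padic_norm (p : nat) (q : rat) : rat :=
  if q == 0 then 0 else p%:R ^ (- padic_val p q).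

Section padic_norm_theory.
Context (p : nat) (p_pr : prime p).
Local Notation norm := (padic_norm p).

Let p_gt0 : 0 < p%:R :> rat. Proof. by rewrite ltr0n prime_gt0. Qed.
Let p_gt1 : 1 < p%:R :> rat. Proof. by rewrite ltr1n prime_gt1. Qed.

Lemma padic_norm0 : norm 0 = 0. Proof. by rewrite /padic_norm eqxx. Qed.

Lemma padic_norm_gt0 q : q != 0 -> 0 < norm q.
Proof. by move=> q0; rewrite /padic_norm (negbTE q0) exprz_gt0. Qed.

Lemma padic_norm_ge0 q : 0 <= norm q.
Proof.
by have [->|/padic_norm_gt0/ltW//] := eqVneq q 0; rewrite padic_norm0.
Qed.

Lemma padic_val_frac (a b : int) : a != 0 -> b != 0 ->
  padic_val p (a%:~R / b%:~R) = (logn p `|a|)%:Z - (logn p `|b|)%:Z.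
Proof.
move=> a0 b0; rewrite /padic_val; set q := (_ / _).
have q0 : q != 0 by rewrite mulf_neq0 ?invr_eq0 ?intr_eq0.
have /(congr1 absz) : numq q * b = a * denq q.
  apply: (@intr_inj rat); rewrite !rmorphM /= numqE /q.
  by field; rewrite intr_eq0.
rewrite !abszM => /(congr1 (logn p)).
rewrite !lognM ?absz_gt0 ?numq_eq0 ?denq_neq0 //; lia.
Qed.

Lemma padic_normM q r : norm (q * r) = norm q * norm r.
Proof.
have [->|q0] := eqVneq q 0; first by rewrite mul0r padic_norm0 mul0r.
have [->|r0] := eqVneq r 0; first by rewrite mulr0 padic_norm0 mulr0.
rewrite /padic_norm mulf_eq0 (negbTE q0) (negbTE r0) /=.
rewrite -expfzDr ?gt_eqF//; congr (_ ^ _).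
have -> : q * r = (numq q * numq r)%:~R / (denq q * denq r)%:~R.
  rewrite !rmorphM /= !numqE; field.
  by rewrite !intr_eq0 !denq_neq0.
rewrite padic_val_frac ?mulf_neq0 ?numq_eq0 ?denq_neq0 // !abszM.
rewrite !lognM ?absz_gt0 ?numq_eq0 ?denq_neq0 // /padic_val; lia.
Qed.

Lemma padic_norm1 : norm 1 = 1.
Proof. by rewrite /padic_norm oner_eq0 /padic_val /= logn1. Qed.

Lemma padic_normN q : norm (- q) = norm q.
Proof.
rewrite /padic_norm oppr_eq0 /padic_val numqN denqN abszN.
by case: (q == 0).
Qed.

Lemma padic_normV q : norm q^-1 = (norm q)^-1.
Proof.
have [->|q0] := eqVneq q 0; first by rewrite invr0 !padic_norm0 ?invr0.
apply: (mulfI (lt0r_neq0 (padic_norm_gt0 q0))).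
by rewrite -padic_normM !divff ?padic_norm1 // lt0r_neq0 // padic_norm_gt0.
Qed.

Lemma padic_norm_le1 q : (norm q <= 1) = ~~ (p %| `|denq q|)%N.
Proof.
have [->|q0] := eqVneq q 0.
  by rewrite padic_norm0 ler01 /= dvdn1 gtn_eqF // prime_gt1.
rewrite /padic_norm (negbTE q0) -[X in _ <= X](expr0z p%:R) ler_eXz2l //.
have d0 : (0 < `|denq q|)%N by rewrite absz_gt0 denq_neq0.
have n0 : (0 < `|numq q|)%N by rewrite absz_gt0 numq_eq0.
apply/idP/idP => [|h].
  apply: contraL => pd; have := coprime_num_den q.
  have pn : ~~ (p %| `|numq q|)%N.
    apply/negP => pn; have := coprime_num_den q.
    rewrite /coprime => /eqP e; have : (p %| gcdn `|numq q| `|denq q|)%N.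
      by rewrite dvdn_gcd pn.
    by rewrite e dvdn1 gtn_eqF // prime_gt1.
  move=> _; rewrite /padic_val -ltNge oppr_gt0.
  have : (0 < logn p `|denq q|)%N by rewrite logn_gt0 mem_primes p_pr d0.
  have : logn p `|numq q| = 0%N.
    by apply/eqP; rewrite -leqn0 leqNgt logn_gt0 mem_primes p_pr n0.
  lia.
have : logn p `|denq q| = 0%N.
  by apply/eqP; rewrite -leqn0 leqNgt logn_gt0 mem_primes p_pr d0.
rewrite /padic_val; lia.
Qed.

Lemma padic_norm_int (a : int) : norm a%:~R <= 1.
Proof. by rewrite padic_norm_le1 denq_int dvdn1 gtn_eqF // prime_gt1. Qed.

Lemma padic_normD1 q : norm q <= 1 -> norm (1 + q) <= 1.
Proof.
move=> q1; have -> : 1 + q = (denq q + numq q)%:~R * (denq q)%:~R^-1.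
  by rewrite rmorphD /= numqE; field; rewrite intr_eq0 denq_neq0.
rewrite padic_normM padic_normV.
have -> : norm (denq q)%:~R = 1.
  rewrite /padic_norm intr_eq0 denq_eq0 /padic_val numq_int denq_int.
  move: q1; rewrite padic_norm_le1 => h.
  have -> : logn p `|denq q| = 0%N.
    by apply/eqP; rewrite -leqn0 leqNgt logn_gt0 mem_primes p_pr /= (negbTE h) andbF.
  by rewrite logn1.
by rewrite invr1 mulr1 padic_norm_int.
Qed.

Lemma padic_normD q r : norm (q + r) <= Num.max (norm q) (norm r).
Proof.
wlog qr : q r / norm q <= norm r.
  move=> H; case/orP: (le_total (norm q) (norm r)) => h; first exact: H.
  by rewrite addrC maxC H.
rewrite (max_idPr qr).
have [r0|r0] := eqVneq r 0.
  by move: qr; rewrite r0 addr0.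
have -> : q + r = r * (1 + q / r) by field.
rewrite padic_normM -{2}(mulr1 (norm r)) ler_wpM2l ?padic_norm_ge0 //.
apply: padic_normD1; rewrite padic_normM padic_normV.
by rewrite ler_pdivrMr ?padic_norm_gt0 // mul1r.
Qed.

Lemma padic_norm_lt q r e : norm q < e -> norm r < e -> norm (q - r) < e.
Proof.
by move=> qe re; apply: le_lt_trans (padic_normD _ _) _; rewrite padic_normN gt_max qe.
Qed.

Lemma padic_norm_distC q r : norm (q - r) = norm (r - q).
Proof. by rewrite -padic_normN opprB. Qed.

Lemma padic_norm_eq q r : norm (q - r) < norm r -> norm q = norm r.
Proof.
move=> h; have := padic_normD (q - r) r.
rewrite subrK (max_idPr (ltW h)) => qr.
have := padic_normD q (r - q); rewrite addrC subrK padic_norm_distC le_max => /orP[rq|].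
  by apply/eqP; rewrite eq_le qr.
by rewrite leNgt h.
Qed.

End padic_norm_theory.

Section padic_cauchy.
Context (p : nat) (p_pr : prime p).
Local Notation norm := (padic_norm p).

Definition padic_cauchy : {pred nat -> rat} := fun u =>
  `[< forall e : rat, 0 < e -> exists n, forall i j,
      (n <= i)%N -> (n <= j)%N -> norm (u i - u j) < e >].

Lemma padic_cauchy_bounded u : u \in padic_cauchy ->
  exists2 M, 0 < M & forall i, norm (u i) <= M.
Proof.
move=> /asboolP /(_ 1 ltr01) [n un].
pose M := \sum_(i < n.+1) norm (u i) + 1.
have M1 : 1 <= M by rewrite lerDr sumr_ge0 // => i _; exact: padic_norm_ge0.
have uM i : (i <= n)%N -> norm (u i) <= M.
  move=> ni; rewrite -ltnS in ni; rewrite /M (bigD1 (Ordinal ni)) //=.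
  by rewrite -addrA lerDl addr_ge0 // sumr_ge0 // => j _; exact: padic_norm_ge0.
exists M; first exact: lt_le_trans M1.
move=> i; have [/uM//|/ltnW ni] := leqP i n.
rewrite -(subrK (u n) (u i)); apply: le_trans (padic_normD p_pr _ _) _.
by rewrite ge_max uM // andbT; apply: le_trans M1; apply/ltW/un.
Qed.

Fact padic_cauchy_subring : subring_closed padic_cauchy.
Proof.
split.
- by apply/asboolP => e e0; exists 0%N => i j _ _; rewrite subrr padic_norm0.
- move=> u v /asboolP cu /asboolP cv; apply/asboolP => e e0.
  have [n un] := cu e e0; have [m vm] := cv e e0.
  exists (maxn n m) => i j; rewrite !geq_max => /andP[ni mi] /andP[nj mj].
  have -> : (u - v) i - (u - v) j = (u i - u j) - (v i - v j).
    by rewrite !fctE; ring.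
  by apply: padic_norm_lt => //; [exact: un|exact: vm].
- move=> u v cu cv; have [M M0 uM] := padic_cauchy_bounded cu.
  have [K K0 vK] := padic_cauchy_bounded cv.
  move: cu cv => /asboolP cu /asboolP cv; apply/asboolP => e e0.
  have [n un] := cu (e / K) (divr_gt0 e0 K0).
  have [m vm] := cv (e / M) (divr_gt0 e0 M0).
  exists (maxn n m) => i j; rewrite !geq_max => /andP[ni mi] /andP[nj mj].
  have -> : (u * v) i - (u * v) j = (u i - u j) * v i - u j * (v j - v i).
    by rewrite !fctE; ring.
  apply: padic_norm_lt => //; rewrite padic_normM //.
    have := un i j ni nj; rewrite ltr_pdivlMr //; apply: le_lt_trans.
    by rewrite ler_wpM2l // padic_norm_ge0.
  have := vm j i mj mi; rewrite ltr_pdivlMr // mulrC; apply: le_lt_trans.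
  by rewrite ler_wpM2r // padic_norm_ge0.
Qed.


End padic_cauchy.

(* The primality proof is an index of the type, not a field: it is from there
   that the ring structure of [padic_seq] and the field structure of [Qp] below
   are inferred. *)
Record padic_seq (p : nat) (p_pr : prime p) := PadicSeq {
  padic_seq_val :> nat -> rat;
  _ : padic_seq_val \in padic_cauchy p }.

Section padic_numbers.
Context (p : nat) (p_pr : prime p).
Local Notation norm := (padic_norm p).
Local Notation padic_seq := (padic_seq p_pr).

HB.instance Definition _ := [isSub for @padic_seq_val p p_pr].
HB.instance Definition _ := [Choice of padic_seq by <:].
HB.instance Definition _ :=
  GRing.SubChoice_isSubComNzRing.Build _ (padic_cauchy p) padic_seq
    (padic_cauchy_subring p_pr).

Lemma padic_seqP (u : padic_seq) (e : rat) : 0 < e ->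
  exists n, forall i j, (n <= i)%N -> (n <= j)%N -> norm (u i - u j) < e.
Proof. by case: u => u /= /asboolP; apply. Qed.

Definition padic_null : {pred padic_seq} := fun u =>
  `[< forall e : rat, 0 < e -> exists n, forall i,
      (n <= i)%N -> norm (u i) < e >].

Fact padic_null_idealr : idealr_closed padic_null.
Proof.
split.
- by apply/asboolP => e e0; exists 0%N => i _; rewrite padic_norm0.
- apply/negP => /asboolP /(_ 1 ltr01) [n /(_ n (leqnn n))].
  by rewrite padic_norm1 ltxx.
- move=> a u v /asboolP nu /asboolP nv; apply/asboolP => e e0.
  have [M M0 aM] := padic_cauchy_bounded p_pr (valP a).
  have [n un] := nu (e / M) (divr_gt0 e0 M0); have [m vm] := nv e e0.
  exists (maxn n m) => i; rewrite geq_max => /andP[ni mi].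
  rewrite -[_ i]/(a i * u i + v i) -(opprK (v i)).
  apply: padic_norm_lt => //; last by rewrite padic_normN //; exact: vm.
  rewrite padic_normM //; have := un i ni; rewrite ltr_pdivlMr // mulrC.
  by apply: le_lt_trans; rewrite ler_wpM2r // ?padic_norm_ge0 //; exact: aM.
Qed.

HB.instance Definition _ := isIdealr.Build _ padic_null padic_null_idealr.

Lemma padic_seq_norm_cst (u : padic_seq) : u \notin padic_null ->
  exists2 c, 0 < c & exists n, forall i, (n <= i)%N -> norm (u i) = c.
Proof.
move=> /asboolPn/existsNP[e /not_implyP[e0 /forallNP nu]].
have [n un] := padic_seqP u e0.
have /existsNP[i /not_implyP[ni /negP]] := nu n; rewrite -leNgt => ei.
exists (norm (u i)); first exact: lt_le_trans ei.
exists n => j nj; apply: padic_norm_eq => //.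
exact: lt_le_trans (un j i nj ni) ei.
Qed.

Definition Qp : Type := {ideal_quot padic_null}.
HB.instance Definition _ := GRing.ComNzRing.on Qp.
HB.instance Definition _ := NzRingQuotient.on Qp.
HB.instance Definition _ := isPointed.Build Qp 0.

Lemma Qp_pi_eq0 (u : padic_seq) : (\pi_Qp u == 0) = (u \in padic_null).
Proof.
by rewrite -[in RHS](subr0 u) Quotient.idealrBE -(rmorph0 \pi_Qp).
Qed.


Definition Qp_inv (x : Qp) : Qp := xget 0 [set y | y * x = 1].

Fact Qp_mulVf (x : Qp) : x != 0 -> Qp_inv x * x = 1.
Proof.
move=> x0; rewrite /Qp_inv; apply: (@xgetPex _ 0 [set y | y * x = 1]).
elim/quotW: x x0 => u; rewrite Qp_pi_eq0.
move=> /padic_seq_norm_cst[c c0 [n un]].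
have uN0 i : (n <= i)%N -> u i != 0.
  by move=> ni; apply: contraL c0 => /eqP ui; rewrite -(un i ni) ui padic_norm0 ltxx.
have cv : (fun i => (u i)^-1) \in padic_cauchy p.
  apply/asboolP => e e0.
  have [m um] := padic_seqP u (mulr_gt0 e0 (mulr_gt0 c0 c0)).
  exists (maxn n m) => i j; rewrite !geq_max => /andP[ni mi] /andP[nj mj].
  have -> : (u i)^-1 - (u j)^-1 = (u j - u i) / (u i * u j).
    by field; rewrite !uN0.
  rewrite padic_normM // padic_normV // padic_normM // !un //.
  by rewrite ltr_pdivrMr ?mulr_gt0 // um.
exists (\pi_Qp (PadicSeq p_pr cv)); apply/eqP.
rewrite -subr_eq0 -(rmorph1 \pi_Qp) -rmorphM -rmorphB /= Qp_pi_eq0.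
apply/asboolP => e e0.
exists n => i ni; rewrite -[_ i]/((u i)^-1 * u i - 1).
by rewrite mulVf ?uN0 // subrr padic_norm0.
Qed.

Fact Qp_inv0 : Qp_inv 0 = 0.
Proof.
by apply: xgetPN => y; rewrite /= mulr0 => /eqP; rewrite eq_sym oner_eq0.
Qed.

HB.instance Definition _ := GRing.ComNzRing_isField.Build Qp Qp_mulVf Qp_inv0.

End padic_numbers.

Section padic_abs.
Context (R : realType) (p : nat) (p_pr : prime p).
Local Notation norm := (padic_norm p).
Local Notation Qp := (Qp p_pr).
Implicit Types (u v : padic_seq p_pr) (x y : Qp).

(* The norms of the terms of a Cauchy sequence converge in R (they are even
   eventually constant unless the limit is 0), see [padic_abs_pi]. *)
Definition padic_abs x : R := limn (fun n => ratr (norm (repr x n)) : R).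

Lemma padic_abs_pi u :
  (ratr (norm (u n)) : R) @[n --> \oo] --> padic_abs (\pi_Qp u).
Proof.
have null_cvg v : v \in @padic_null p p_pr -> (ratr (norm (v n)) : R) @[n --> \oo] --> 0.
  move=> /asboolP nv; apply/cvgrPdist_lt => e e0.
  have [q /itvP qe] := rat_in_itvoo e0.
  have [n vn] := nv q (ltac:(by rewrite -(ltr0q R) qe)).
  exists n => // i /= ni; rewrite sub0r normrN ger0_norm ?ler0q ?padic_norm_ge0 //.
  by apply: lt_trans (_ : ratr q < e); rewrite ?ltr_rat ?vn // qe.
rewrite /padic_abs; set w := repr _.
have wu : w - u \in @padic_null p p_pr by rewrite Quotient.idealrBE reprK.
have [nu|/padic_seq_norm_cst[c c0 [n un]]] := boolP (u \in @padic_null p p_pr).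
  have nw : w \in @padic_null p p_pr by rewrite -(subrK u w) rpredD.
  by rewrite (cvg_lim _ (null_cvg _ nw)) //; exact: null_cvg.
have cst_cvg v m : (forall i, (m <= i)%N -> norm (v i) = c) ->
    (ratr (norm (v k)) : R) @[k --> \oo] --> (ratr c : R).
  move=> vm; apply/cvgrPdist_lt => e e0; exists m => // i /= /vm ->.
  by rewrite subrr normr0.
have [m wm] : exists m, forall i, (m <= i)%N -> norm (w i) = c.
  have /asboolP /(_ c c0) [m wm] := wu.
  exists (maxn n m) => i; rewrite geq_max => /andP[ni mi].
  by rewrite -(un i ni); apply: padic_norm_eq => //; rewrite un //; exact: wm.
by rewrite (cvg_lim _ (cst_cvg _ _ wm)) //; exact: cst_cvg un.
Qed.

Lemma padic_abs_lim u (l : R) :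
  (ratr (norm (u n)) : R) @[n --> \oo] --> l -> padic_abs (\pi_Qp u) = l.
Proof. by move=> ul; apply: (cvg_unique _ (@padic_abs_pi u) ul). Qed.

Lemma padic_abs0 : padic_abs 0 = 0.
Proof.
rewrite -(rmorph0 \pi_Qp); apply: padic_abs_lim.
rewrite (_ : (fun n => _) = cst 0); first exact: cvg_cst.
by apply/funext => n; rewrite padic_norm0 rmorph0.
Qed.

Lemma padic_absM x y : padic_abs (x * y) = padic_abs x * padic_abs y.
Proof.
elim/quotW: x => u; elim/quotW: y => v; rewrite -rmorphM /=.
apply: padic_abs_lim.
rewrite (_ : (fun n => _) = fun n => ratr (norm (u n)) * ratr (norm (v n))).
  by apply: cvgM; exact: padic_abs_pi.
by apply/funext => n; rewrite -[(u * v) n]/(u n * v n) padic_normM // rmorphM.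
Qed.

Lemma padic_absN x : padic_abs (- x) = padic_abs x.
Proof.
elim/quotW: x => u; rewrite -rmorphN /=.
apply: padic_abs_lim.
rewrite (_ : (fun n => _) = fun n => ratr (norm (u n))); first exact: padic_abs_pi.
by apply/funext => n; rewrite -[(- u) n]/(- u n) padic_normN.
Qed.

Lemma padic_absD x y :
  padic_abs (x + y) <= Num.max (padic_abs x) (padic_abs y).
Proof.
elim/quotW: x => u; elim/quotW: y => v; rewrite -rmorphD /=.
have cuv := @padic_abs_pi (u + v); rewrite maxr_absE.
set M := (_ / 2).
have cM : (Num.max (ratr (norm (u n))) (ratr (norm (v n))) : R) @[n --> \oo] --> M.
  rewrite (_ : (fun n => _) = fun n => (ratr (norm (u n)) + ratr (norm (v n)) +
    `|ratr (norm (u n)) - ratr (norm (v n))|) / 2).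
    apply: cvgMl; apply: cvgD; first by apply: cvgD; exact: padic_abs_pi.
    by apply: cvg_norm; apply: cvgB; exact: padic_abs_pi.
  by apply/funext => n; rewrite maxr_absE.
rewrite -(cvg_lim _ cuv) // -(cvg_lim _ cM) //.
apply: ler_lim; [exact: cvgP cuv|exact: cvgP cM|apply: nearW => n].
rewrite -[(u + v) n]/(u n + v n) le_max !ler_rat -le_max.
exact: padic_normD.
Qed.

Definition padic_open : set (set Qp) := [set U | forall x, U x ->
  exists2 r : R, 0 < r & forall y, padic_abs (y - x) < r -> U y].

(* Q_p with its Borel sigma-algebra; convertible to [Qp p_pr]. *)
Definition Qp_borel := g_sigma_algebraType padic_open.

(* Integer exponent: [p%:R ^ N] with [N : int], possibly negative. *)
Definition padic_ball (N : int) : set Qp := [set x | padic_abs x <= p%:R ^ N].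

Lemma measurable_padic_ball (N : int) :
  measurable (padic_ball N : set Qp_borel).
Proof.
apply: sub_sigma_algebra => x xN; exists (p%:R ^ N).
  by rewrite exprz_gt0 // ltr0n prime_gt0.
move=> y yx; rewrite /padic_ball /= -(subrK x y).
by apply: le_trans (padic_absD _ _) _; rewrite ge_max (ltW yx).
Qed.

(* {x}_p is the unique r in Z[1/p] with 0 <= r < 1 and x - r in Z_p. *)
Definition padic_frac x : rat := xget 0 [set r : rat |
  [/\ 0 <= r < 1, exists k, r * p%:R ^+ k \is a Num.int &
      padic_abs (x - ratr r) <= 1]].

Definition padic_char x : R[i] :=
  let th := 2 * pi * ratr (padic_frac x) in (cos th +i* sin th)%C.

(* Haar measure is determined by these two conditions: Q_p is locally compact
   and second countable, so a translation invariant Borel measure that is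
   finite and nonzero on Z_p is Haar measure. *)
Record normalized_haar (mu : {measure set Qp_borel -> \bar R}) : Prop := {
  haar_translation : forall (x : Qp) (A : set Qp_borel), measurable A ->
    mu [set x + y | y in A] = mu A ;
  haar_Zp : mu (padic_ball 0) = 1%E }.

End padic_abs.

Definition L1norm d (X : measurableType d) (R : realType)
    (nu : {measure set X -> \bar R}) (f : X -> R) : \bar R :=
  'N[nu]_1[EFin \o f]%E.

Section heat_semigroup.
Context (R : realType) (p : nat) (p_pr : prime p).
Context (mu : {measure set (Qp_borel R p_pr) -> \bar R}) (N : int) (alpha : R).
Local Notation Qp := (Qp p_pr).
Local Notation pR := (p%:R : R).

(* Haar measure of B_N, seen as a measure on Q_p that ignores the complement of
   B_N.  Thus L^q(B_N) is [Lfun (haar_ball mu N) q], a function on B_N being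
   represented by any measurable extension of it to Q_p, and statements
   holding [haar_ball]-almost everywhere are statements about a.e. point of
   B_N. *)
Definition haar_ball : set (Qp_borel R p_pr) -> \bar R :=
  mrestr mu (@measurable_padic_ball R p p_pr N).
HB.instance Definition _ := Measure.on haar_ball.

Definition integralC (f : Qp -> R[i]) : R[i] :=
  ((\int[mu]_x complex.Re (f x))%R +i* (\int[mu]_x complex.Im (f x))%R)%C.

Definition heat_kernelC (t : R) (x : Qp) : R[i] :=
  integralC (fun xi => padic_char R (xi * x) *
                       (expR (- t * padic_abs R xi `^ alpha))%:C%C).

(* The imaginary part of [heat_kernelC] vanishes because the integrand is
   Hermitian: conj (chi (xi * x)) = chi (- xi * x).  Taking the real part only
   serves to obtain a real-valued kernel. *)
Definition heat_kernel (t : R) (x : Qp) : R := complex.Re (heat_kernelC t x).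

Definition lambdaN : R :=
  (pR - 1) / (pR `^ (alpha + 1) - 1) * pR `^ (alpha * (1 - N%:~R)).

Definition cN (t : R) : R :=
  pR ^ (- N) - pR ^ (- N) * (1 - pR^-1) * expR (lambdaN * t) *
  limn (series (fun n : nat => (-1) ^+ n / n`!%:R * t ^+ n *
    (pR `^ (- N%:~R * alpha * n%:R) / (1 - pR `^ (- alpha * n%:R - 1))))).

Definition ball_heat_kernel (t : R) (x : Qp) : R :=
  expR (lambdaN * t) * heat_kernel t x + cN t.

Definition ball_semigroup (t : R) (u : Qp -> R) (x : Qp) : R :=
  if t == 0 then u x
  else (\int[haar_ball]_y (ball_heat_kernel t (x - y) * u y))%R.

(* Unbounded and nonlinear operators on L^1 are represented by their graphs.
   [generatorAN u g] says A_N u = g; with T_N(t) = exp(- t A_N) the difference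
   quotient is (u - T_N(t) u) / t. *)
Definition generatorAN (u g : Qp -> R) : Prop :=
  [/\ u \in Lfun haar_ball 1, g \in Lfun haar_ball 1 &
      L1norm haar_ball (fun x => (u x - ball_semigroup t u x) / t - g x)
        @[t --> 0^'+] --> 0%E].

(* (A_N + lambdaN) u = g. *)
Definition DN (u g : Qp -> R) : Prop :=
  generatorAN u (fun x => g x - lambdaN * u x).

Definition DN_comp (Phi : R -> R) (u g : Qp -> R) : Prop :=
  u \in Lfun haar_ball 1 /\ DN (Phi \o u) g.

End heat_semigroup.

(* Mild solutions, in the sense of nonlinear semigroup theory, of
   u' + A u = 0, u(0) = u0 in L^1(nu): continuous curves that are uniform limits
   of implicit Euler schemes.  For an m-accretive A this is the function given by
   the exponential formula u(t) = lim_k (I + t/k A)^(-k) u0. *)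
Section mild_solution.
Context d (X : measurableType d) (R : realType) (nu : {measure set X -> \bar R}).
Context (A : (X -> R) -> (X -> R) -> Prop).
Local Notation L1 := (Lfun nu 1).

(* 0 = s_0 < ... < s_n is a partition of mesh < e reaching T up to e; z_i is the
   value of the scheme on ]s_(i-1), s_i]; f_i (only used for 0 < i <= n) is the
   error, of total L^1 size < e, in
   (z_i - z_(i-1)) / (s_i - s_(i-1)) + A z_i = f_i. *)
Record approx_solution (T e : R) (u0 : X -> R) (n : nat) (s : nat -> R)
    (z f : nat -> X -> R) : Prop := {
  approx_start : s 0%N = 0 ;
  approx_mesh : forall i, (i < n)%N -> 0 < s i.+1 - s i < e ;
  approx_end : T - e < s n <= T ;
  approx_z_L1 : forall i, (i <= n)%N -> z i \in L1 ;
  approx_f_L1 : forall i, (i < n)%N -> f i.+1 \in L1 ;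
  approx_source :
    (\sum_(i < n) (s i.+1 - s i)%:E * L1norm nu (f i.+1) < e%:E)%E ;
  approx_initial : (L1norm nu (z 0%N \- u0)%R <= e%:E)%E ;
  approx_scheme : forall i, (i < n)%N -> exists2 g, A (z i.+1) g &
    {ae nu, forall x, (z i.+1 x - z i x) / (s i.+1 - s i) + g x = f i.+1 x} }.

Record mild_solution (u0 : X -> R) (u : R -> X -> R) : Prop := {
  mild_L1 : forall t, 0 <= t -> u t \in L1 ;
  mild_continuous : forall t, 0 <= t ->
    L1norm nu (u s \- u t) @[s --> within [set s | 0 <= s] (nbhs t)]
      --> 0%E ;
  mild_initial : {ae nu, forall x, u 0 x = u0 x} ;
  mild_approx : forall T e, 0 < T -> 0 < e -> exists n s z f,
    [/\ approx_solution T e u0 n s z f,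
        (L1norm nu (u 0 \- z 0%N)%R <= e%:E)%E &
        forall i, (i < n)%N -> forall t, s i < t <= s i.+1 ->
          (L1norm nu (u t \- z i.+1)%R <= e%:E)%E ] }.

End mild_solution.

(* Main.v *)
(** A convex [j >= 0] with [j 0 = 0] and bounded subgradient [q] cannot increase
    its integral along implicit Euler steps of [u' + D (Phi u) = 0], provided that
    [int q(z) D(Phi z) >= 0].  Hence [int j(u t) <= int j(u0)] for the mild
    solution; letting [j] increase to [|r|^gamma] (or taking [j = (|r| - M)^+]
    with [M] the essential supremum of [|u0|]) bounds the norms.

    Writing [v = Phi z], which is comonotone with [q(z)], the accretivity reduces
    to [int q(z) (v - T_t v) >= 0], and this holds because the kernel of [T_t] on
    [B_N] is symmetric, nonnegative and of mass at most 1.  For the last two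
    properties decompose [exp (- t |xi|^alpha)] into balls as [sum_k w_k 1_(B_k)]
    with [w_k >= 0]; its Fourier transform is [sum_k w_k p^k 1_(B_(-k))].  On [B_N]
    the terms with [k <= -N] are constant, and summation by parts gives their sum
    as [p^(-N) ((1 - p^-1) S - exp (- t p^(alpha (1 - N))))], where [S] is the
    series occurring in [c(t)].  Hence [Z_N(t, x) >= p^(-N) (1 - exp (t (lambda -
    p^(alpha (1 - N)))))] for [x] in [B_N], which is nonnegative because
    [lambda <= p^(alpha (1 - N))]. *)

(* The Euler scheme is controlled in $L^1$ only. The value $g = D(\Phi(z))$ at a step is merely
   integrable, so it can be paired only with a bounded test function; the errors of the scheme, its
   initial mismatch and its distance to $u(t)$ are small only in the $L^1$ norm, so $\int j$ must be
   Lipschitz for that norm. Both demands force $q$ to be bounded, and $|r|^\gamma$ is reached only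
   in the limit.

   On the linear side, [haar_ball] lives on all of $\mathbb Q_p$, while $Z_N \ge 0$ is available on
   $B_N$ only. Since differences of points of $B_N$ stay in $B_N$, the kernel $Z_N(t, x - y)$ can be
   cut off to $B_N \times B_N$ without changing the semigroup almost everywhere on $B_N$.

   The mass bound comes from the same decomposition into balls: $\int_{B_N} Z(t, x - y)\,dy \le (1 -
   p^{-1}) S$, whereas $c(t)$ times the measure $p^N$ of $B_N$ is $1 - (1 - p^{-1}) e^{\lambda t}
   S$. So $S$ cancels in the mass exactly as it does in the lower bound, and $S$ itself never has to
   be estimated. *)
Require Import Defs.
From HB Require Import structures.
From mathcomp Require Import all_boot all_order all_algebra.
From mathcomp Require Import all_classical all_reals all_analysis.
From mathcomp Require Import measurable_realfun ess_sup_inf complex.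
From mathcomp Require Import ring lra zify.
Set Implicit Arguments.
Unset Strict Implicit.
Unset Printing Implicit Defensive.
Import Order.TTheory GRing.Theory Num.Theory.
Import numFieldNormedType.Exports.
Local Open Scope classical_set_scope.
Local Open Scope ring_scope.

(** * Symmetric sub-Markov kernels *)

Section bounded_kernel.
Context d (X : measurableType d) (R : realType).
Variable nu : {finite_measure set X -> \bar R}.
Variables (k : X * X -> R) (C : R).
Hypothesis k_meas : measurable_fun setT k.
Hypothesis k_bounded : forall x y, `|k (x, y)| <= C.

Let C_ge0 (x : X) : 0 <= C. Proof. exact: le_trans (k_bounded x x). Qed.

(** Tonelli with the majorant $C |f(x)| |g(y)|$. Every exchange of integrals in the accretivity
    argument rests on it. *)
Lemma integrable_kernel (f g : X -> R) :
  nu.-integrable setT (EFin \o f) -> nu.-integrable setT (EFin \o g) ->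
  (nu \x nu)%E.-integrable setT (fun z => (k z * f z.1 * g z.2)%:E).
Proof.
move=> fi gi.
have mf : measurable_fun setT f by apply/measurable_EFinP/(measurable_int nu).
have mg : measurable_fun setT g by apply/measurable_EFinP/(measurable_int nu).
apply/integrable12ltyP => /=.
  apply/measurable_EFinP; apply: measurable_funM; first apply: measurable_funM => //.
    exact: measurableT_comp mf measurable_fst.
  exact: measurableT_comp mg measurable_snd.
have h0 x : (0 <= (C * `|f x|)%:E)%E.
  by rewrite lee_fin mulr_ge0 // (C_ge0 x).
have gfin : (\int[nu]_y (`|g y|)%:E)%E \is a fin_num.
  have /integrable_norm := gi; exact: integrable_fin_num.
apply: (@le_lt_trans _ _ (\int[nu]_x \int[nu]_y ((C * `|f x|)%:E * (`|g y|)%:E)))%E.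
  have mh : measurable_fun setT (fun z : X * X => ((C * `|f z.1|)%:E * (`|g z.2|)%:E)%E).
    apply: emeasurable_funM; apply/measurable_EFinP.
      apply: measurable_funM => //; apply: measurableT_comp => //.
      exact: measurableT_comp mf measurable_fst.
    apply: measurableT_comp => //; exact: measurableT_comp mg measurable_snd.
  have mk : measurable_fun setT (fun z : X * X => (`|(k z * f z.1 * g z.2)%:E|)%E).
    apply: measurableT_comp => //; apply/measurable_EFinP.
    apply: measurable_funM; first apply: measurable_funM => //.
      exact: measurableT_comp mf measurable_fst.
    exact: measurableT_comp mg measurable_snd.
  apply: ge0_le_integral => //.
  - by move=> x _; apply: integral_ge0.
  - exact: (measurable_fun_fubini_tonelli_F _ mk).
  - by apply: (measurable_fun_fubini_tonelli_F _ mh) => z; rewrite mule_ge0.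
  move=> x _; apply: ge0_le_integral => //.
  - by apply: (measurableT_comp mk); exact: measurable_pair1.
  - by apply: measurable_funeM; apply/measurable_EFinP; exact: measurableT_comp.
  by move=> y _ /=; rewrite lee_fin !normrM ler_wpM2r // ler_wpM2r.
rewrite (eq_integral (fun x => ((C * `|f x|)%:E * \int[nu]_y (`|g y|)%:E)%E)); last first.
  move=> x _; rewrite ge0_integralZl_EFin //=.
    by apply/measurable_EFinP; exact: measurableT_comp.
  by have := h0 x; rewrite lee_fin.
have /integrable_norm/(integrableZl measurableT C) fC := fi.
under eq_integral do rewrite muleC.
rewrite ge0_integralZl //=; [|exact: measurable_int fC|exact: integral_ge0].
apply: lte_mul_pinfty; [exact: integral_ge0|exact: gfin|].
exact: integrable_lty fC.
Qed.

(** The idle factor [1] gives the integrand the shape treated by [integrable_kernel], with the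
    constant function in the variable [x]. *)
Lemma kernel_opE (v : X -> R) x : nu.-integrable setT (EFin \o v) ->
  (\int[nu]_y (k (x, y) * v y))%R%:E = (\int[nu]_y (k (x, y) * 1 * v y)%:E)%E.
Proof.
move=> vi; rewrite /Rintegral; under [in RHS]eq_integral do rewrite mulr1.
rewrite fineK //.
have mv : measurable_fun setT v by apply/measurable_EFinP/(measurable_int nu).
apply: integrable_fin_num => //; apply: le_integrable (integrableZl measurableT C vi) => //.
  apply/measurable_EFinP; apply: measurable_funM => //.
  by apply: (measurableT_comp k_meas); exact: measurable_pair1.
by move=> y _; rewrite -EFinM lee_fin !normrM ler_wpM2r // (ger0_norm (C_ge0 x)).
Qed.

Lemma integrable_kernel_op (v : X -> R) : nu.-integrable setT (EFin \o v) ->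
  nu.-integrable setT (fun x => (\int[nu]_y (k (x, y) * v y))%R%:E).
Proof.
move=> vi.
have i1 : nu.-integrable setT (EFin \o (cst 1 : X -> R)).
  exact: finite_measure_integrable_cst.
have := integrable_fubini_F (integrable_kernel i1 vi).
apply: eq_integrable => // x _.
by rewrite kernel_opE.
Qed.

Hypothesis k_ge0 : forall x y, 0 <= k (x, y).
Hypothesis k_sym : forall x y, k (x, y) = k (y, x).
Hypothesis k_mass : forall x, (\int[nu]_y (k (x, y))%:E <= 1)%E.

(* By symmetry and the mass bound, [2 int q (v - K v)] is at least the double
   integral of [k (x, y) (q x - q y) (v x - v y)]. *)
Lemma kernel_accretive (q v : X -> R) (L : R) :
  measurable_fun setT q -> (forall x, `|q x| <= L) ->
  nu.-integrable setT (EFin \o v) ->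
  (forall x, 0 <= q x * v x) ->
  (forall x y, 0 <= (q x - q y) * (v x - v y)) ->
  (\int[nu]_x (q x * (\int[nu]_y (k (x, y) * v y))%R)%:E <=
   \int[nu]_x (q x * v x)%:E)%E.
Proof.
move=> mq qL vi qv0 qvm.
have mv : measurable_fun setT v by apply/measurable_EFinP/(measurable_int nu).
have bq : [bounded q x | x in [set: X]].
  by exists L; split; rewrite ?num_real // => M LM x _; apply: le_trans (qL x) (ltW LM).
have qi : nu.-integrable setT (EFin \o q).
  by apply: measurable_bounded_integrable => //; apply: fin_num_fun_lty; exact: fin_num_measure.
have qvi : nu.-integrable setT (EFin \o (q \* v)%R) by exact: (integrableMr _ mq bq vi).
have i1 : nu.-integrable setT (EFin \o (cst 1 : X -> R)).
  exact: finite_measure_integrable_cst.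
have ia := integrable_kernel qvi i1; have ia' := integrable_kernel i1 qvi.
have ib := integrable_kernel qi vi; have ib' := integrable_kernel vi qi.
pose I f := (\int[(nu \x nu)%E]_z (k z * f z.1 z.2)%:E)%E.
have fE (f g : X -> R) : nu.-integrable setT (EFin \o f) -> nu.-integrable setT (EFin \o g) ->
    I (fun x y => f x * g y) = I (fun x y => g x * f y).
  move=> fi gi; rewrite /I.
  under eq_integral do rewrite mulrA.
  under [RHS]eq_integral do rewrite mulrA.
  rewrite -(integral12_prod_meas1 (integrable_kernel fi gi)) /=.
  rewrite -(integral21_prod_meas1 (integrable_kernel gi fi)) /=.
  by apply: eq_integral => x _; apply: eq_integral => y _ /=; rewrite k_sym mulrAC.
(* The mass bound enters here: the inner integral of [k] is at most 1, and it multiplies the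
   nonnegative function [q * v]. *)
have aE : (I (fun x y => q x * v x * 1)%R <= \int[nu]_x (q x * v x)%:E)%E.
  rewrite /I.
  under eq_integral do rewrite mulrA.
  rewrite -(integral12_prod_meas1 ia) /=; apply: ge0_le_integral => //.
  - by move=> x _; apply: integral_ge0 => y _; rewrite lee_fin mulr1 mulr_ge0.
  - exact: measurable_fubini_F ia.
  - exact: measurable_int qvi.
  move=> x _; rewrite /fubini_F /=.
  under eq_integral do rewrite mulr1 mulrC EFinM.
  rewrite ge0_integralZl_EFin //=; last 2 first.
  - by move=> y _; rewrite lee_fin.
  - by apply/measurable_EFinP; by apply: (measurableT_comp k_meas); exact: measurable_pair1.
  by rewrite -[leRHS]mule1 lee_wpmul2l // lee_fin.
have bE : I (fun x y => q x * v y) = (\int[nu]_x (q x * (\int[nu]_y (k (x, y) * v y))%R)%:E)%E.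
  rewrite /I.
  under eq_integral do rewrite mulrA.
  rewrite -(integral12_prod_meas1 ib) /=; apply: eq_integral => x _.
  rewrite EFinM kernel_opE // -integralZl //=.
    by apply: eq_integral => y _ /=; rewrite -EFinM mulr1; congr EFin; ring.
  apply: le_integrable (integrableZl measurableT C vi) => //.
    apply/measurable_EFinP; apply: measurable_funM => //; apply: measurable_funM => //.
    by apply: (measurableT_comp k_meas); exact: measurable_pair1.
  by move=> y _; rewrite -EFinM lee_fin mulr1 !normrM ler_wpM2r // (ger0_norm (C_ge0 x)).
rewrite -bE; apply: le_trans aE.
have iI f g : nu.-integrable setT (EFin \o f) -> nu.-integrable setT (EFin \o g) ->
  (nu \x nu)%E.-integrable setT (fun z => (k z * (f z.1 * g z.2))%:E).
  by move=> fi gi; under eq_fun do rewrite mulrA; exact: integrable_kernel.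
(* The difference is doubled so that [fE], which uses the symmetry of [k], can swap the variables in
   the second copy. The four integrands then add up to $k(x,y)(q(x) - q(y))(v(x) - v(y))$. *)
suff : (0 <= (I (fun x y => (q x * v x) * 1)%R - I (fun x y => q x * v y)%R) +
   (I (fun x y => (q x * v x) * 1)%R - I (fun x y => q x * v y)%R))%E.
  have fa : I (fun x y => (q x * v x) * 1) \is a fin_num by apply: integrable_fin_num => //; exact: (iI (q \* v) (cst 1)).
  have fb : I (fun x y => q x * v y) \is a fin_num by apply: integrable_fin_num => //; exact: iI.
  rewrite -(fineK fa) -(fineK fb) -EFinB -EFinD !lee_fin; lra.
rewrite [in X in (_ <= _ + X)%E](fE q v) // [in X in (_ <= _ + X)%E](fE (q \* v) (cst 1)) //.
have [ja ja'] := (iI (q \* v) (cst 1) qvi i1, iI (cst 1) (q \* v) i1 qvi).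
have [jb jb'] := (iI q v qi vi, iI v q vi qi).
rewrite /I -(integralB measurableT ja jb) -(integralB measurableT ja' jb').
rewrite -integralD //; [|exact: integrableB..].
apply: integral_ge0 => -[x y] _ /=; rewrite -!EFinB -EFinD lee_fin.
have := mulr_ge0 (k_ge0 x y) (qvm x y); congr (0 <= _); ring.
Qed.

End bounded_kernel.

(** * Entropies *)

(* [j] is a Lipschitz convex function vanishing at its minimum [0], and [q] is a
   selection of its subdifferential. *)
Record entropy_pair (R : realType) (j q : R -> R) (L : R) : Prop := {
  entropy_ge0 : forall a, 0 <= j a ;
  entropy0 : j 0 = 0 ;
  entropy_slope_bound : forall a, `|q a| <= L ;
  entropy_tangent : forall a b, j a - j b <= q a * (a - b) }.

Section entropy.
Context d (X : measurableType d) (R : realType).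
Variable nu : {measure set X -> \bar R}.
Variables (j q : R -> R) (L : R).
Hypothesis jq : entropy_pair j q L.
Implicit Types (f g z w : X -> R).

Let j_ge0 := entropy_ge0 jq.
Let j0 := entropy0 jq.
Let q_bound := entropy_slope_bound jq.
Let tangent := entropy_tangent jq.

Lemma entropy_slope_ge0 a : 0 <= q a * a.
Proof. by have := tangent a 0; rewrite subr0 j0 subr0; apply: le_trans. Qed.

Lemma entropy_slope_mono a b : 0 <= (q a - q b) * (a - b).
Proof.
have := lerD (tangent a b) (tangent b a); lra.
Qed.

Lemma entropy_lip a b : j a <= j b + L * `|a - b|.
Proof.
rewrite -lerBlDl; apply: le_trans (tangent a b) _.
by apply: le_trans (ler_norm _) _; rewrite normrM ler_wpM2r.
Qed.

Lemma entropy_bound_ge0 : 0 <= L.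
Proof. exact: le_trans (normr_ge0 (q 0)) _. Qed.

Lemma entropy_slope_measurable : measurable_fun setT q.
Proof.
apply: nondecreasing_measurable => // a b ab.
have [->//|ab'] := eqVneq a b.
have {}ab : 0 < b - a by rewrite subr_gt0 lt_neqAle ab' ab.
by have := entropy_slope_mono b a; rewrite pmulr_lge0 // subr_ge0.
Qed.

Lemma entropy_measurable : measurable_fun setT j.
Proof.
apply: continuous_measurable_fun => a; apply/cvgrPdist_le => e e0.
have L1 : 0 < L + 1 by rewrite ltr_wpDl ?entropy_bound_ge0.
near=> b.
have ab : `|a - b| <= e / (L + 1).
  by near: b; apply: cvgr_dist_le => //; exact: divr_gt0.
apply: (@le_trans _ _ ((L + 1) * `|a - b|)); last by rewrite mulrC -ler_pdivlMr.
have := entropy_lip a b; have := entropy_lip b a; rewrite (distrC b a).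
by rewrite ler_norml; have := normr_ge0 (a - b); lra.
Unshelve. all: by end_near. Qed.

Let j_meas := entropy_measurable.
Let q_meas := entropy_slope_measurable.

Let mcomp (h : R -> R) w : measurable_fun setT h -> measurable_fun setT w ->
  measurable_fun setT (fun x => (h (w x))%:E).
Proof. by move=> mh mw; apply/measurable_EFinP; exact: measurableT_comp. Qed.

Lemma L1normE w : L1norm nu w = (\int[nu]_x (`|w x|)%:E)%E.
Proof. by rewrite /L1norm Lnorm1. Qed.

(** Written as a sum rather than a difference, so that the integral of [j] along [w] may be
    infinite. It absorbs both the initial error of the scheme and its distance to the mild
    solution. *)
Lemma entropy_L1dist z w : measurable_fun setT z -> measurable_fun setT w ->
  (\int[nu]_x (j (z x))%:E <=
   \int[nu]_x (j (w x))%:E + L%:E * L1norm nu (z \- w)%R)%E.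
Proof.
move=> mz mw.
have md : measurable_fun setT (fun x => (`|z x - w x|)%:E).
  by apply/measurable_EFinP; apply: measurableT_comp => //; exact: measurable_funB.
rewrite L1normE -ge0_integralZl_EFin ?entropy_bound_ge0 //.
rewrite -ge0_integralD //.
- apply: ge0_le_integral.
  + by [].
  + by move=> x _; rewrite lee_fin.
  + exact: mcomp.
  + by apply: emeasurable_funD; [exact: mcomp|exact: measurable_funeM].
  + by move=> x _; rewrite -EFinM -EFinD lee_fin; exact: entropy_lip.
- by move=> x _; rewrite lee_fin.
- exact: mcomp.
- by move=> x _; rewrite -EFinM lee_fin mulr_ge0 ?entropy_bound_ge0.
- exact: measurable_funeM.
Qed.

Lemma integrable_entropy z : nu.-integrable setT (EFin \o z) ->
  nu.-integrable setT (fun x => (j (z x))%:E).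
Proof.
move=> zi; have mz : measurable_fun setT z by apply/measurable_EFinP/(measurable_int nu).
apply: (le_integrable measurableT _ _ (integrableZl measurableT L zi)).
  exact: mcomp.
move=> x _; rewrite -EFinM lee_fin !normrM ger0_norm // ger0_norm ?entropy_bound_ge0 //.
by have := entropy_lip (z x) 0; rewrite j0 add0r subr0.
Qed.

Lemma integrable_slope_mul z g :
  measurable_fun setT z -> nu.-integrable setT (EFin \o g) ->
  nu.-integrable setT (fun x => (q (z x) * g x)%:E).
Proof.
move=> mz gi; have mg : measurable_fun setT g by apply/measurable_EFinP/(measurable_int nu).
apply: (le_integrable measurableT _ _ (integrableZl measurableT L gi)).
  apply/measurable_EFinP; apply: measurable_funM => //; exact: measurableT_comp.
move=> x _; rewrite -EFinM lee_fin !normrM ler_wpM2r //.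
by rewrite (ger0_norm entropy_bound_ge0).
Qed.

(** The tangent inequality at [z] gives $j(z) - j(w) \le q(z)(z - w) = h\,q(z)(f - g) \le h L |f| -
    h\,q(z) g$, and the last term has a nonpositive integral by the accretivity assumption. *)
Lemma entropy_step (h : R) z w f g : 0 < h ->
  nu.-integrable setT (EFin \o z) -> nu.-integrable setT (EFin \o w) ->
  nu.-integrable setT (EFin \o f) -> nu.-integrable setT (EFin \o g) ->
  {ae nu, forall x, (z x - w x) / h + g x = f x} ->
  (0 <= \int[nu]_x (q (z x) * g x)%:E)%E ->
  (\int[nu]_x (j (z x))%:E <=
   \int[nu]_x (j (w x))%:E + L%:E * (h%:E * L1norm nu f))%E.
Proof.
move=> h0 zi wi fi gi zE acc.
have mz : measurable_fun setT z by apply/measurable_EFinP/(measurable_int nu).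
(* A representative of [g] for which the equation of the step holds everywhere, so that the final
   comparison is pointwise. *)
pose g' x := f x - h^-1 * (z x - w x).
have g'i : nu.-integrable setT (EFin \o g').
  have := integrableB measurableT fi (integrableZl measurableT h^-1 (integrableB measurableT zi wi)).
  by apply: eq_integrable.
have gg' : (\int[nu]_x (q (z x) * g x)%:E = \int[nu]_x (q (z x) * g' x)%:E)%E.
  apply: ae_eq_integral => //.
  - exact: measurable_int (integrable_slope_mul mz gi).
  - exact: measurable_int (integrable_slope_mul mz g'i).
  apply: filterS zE => x zEx _; rewrite /g' -zEx; congr (_ * _)%:E; ring.
have jzi := integrable_entropy zi; have jwi := integrable_entropy wi.
have qgi := integrable_slope_mul mz g'i.
have fni := integrable_norm fi.
rewrite gg' in acc.
rewrite L1normE muleA -EFinM -integralZl //.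
rewrite -integralD //; last exact: integrableZl.
apply: (@le_trans _ _ (\int[nu]_x (j (z x))%:E + h%:E * \int[nu]_x (q (z x) * g' x)%:E)%E).
  by rewrite leeDl // mule_ge0 // lee_fin ltW.
rewrite -integralZl // -integralD //; last exact: integrableZl.
apply: le_integral => //.
- by apply: integrableD => //; exact: integrableZl.
- by apply: integrableD => //; exact: integrableZl.
move=> x _; rewrite -!EFinM -!EFinD lee_fin /= /g'.
have := tangent (z x) (w x); have : q (z x) * f x <= L * `|f x|.
  by apply: le_trans (ler_norm _) _; rewrite normrM ler_wpM2r.
move=> /(ler_wpM2l (ltW h0)).
have -> : h * (q (z x) * (f x - h^-1 * (z x - w x))) =
  h * (q (z x) * f x) - (h * h^-1) * (q (z x) * (z x - w x)) by ring.
rewrite divff ?gt_eqF //; lra.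
Qed.

(** By accretivity a step costs no more than its own error term. One [L * e] pays for the distance
    from [z 0] to [u0], the other for the total $L^1$ size of the errors [f]. *)
Lemma approx_solution_entropy (A : (X -> R) -> (X -> R) -> Prop)
    (T e : R) (u0 : X -> R) (n : nat) (s : nat -> R) (z f : nat -> X -> R) (i : nat) :
  (forall v g, v \in Lfun nu 1 -> A v g ->
    nu.-integrable setT (EFin \o g) /\ (0 <= \int[nu]_x (q (v x) * g x)%:E)%E) ->
  measurable_fun setT u0 ->
  approx_solution nu A T e u0 n s z f -> (i <= n)%N ->
  (\int[nu]_x (j (z i x))%:E <= \int[nu]_x (j (u0 x))%:E + (L * e + L * e)%:E)%E.
Proof.
move=> acc mu0 [_ mesh _ zL fL source init scheme] ile.
have L0 := entropy_bound_ge0.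
have ms k : (k <= n)%N -> measurable_fun setT (z k).
  by move=> kn; apply/measurable_EFinP/(measurable_int nu)/Lfun1_integrable/zL.
have n0 k : (0 <= L1norm nu (f k))%E by exact: Lnorm_ge0.
have key : (\int[nu]_x (j (z i x))%:E <= \int[nu]_x (j (z 0%N x))%:E +
    L%:E * \sum_(k < i) (s k.+1 - s k)%:E * L1norm nu (f k.+1))%E.
  elim: i ile => [|i IH] ile; first by rewrite big_ord0 mule0 adde0.
  rewrite big_ord_recr /= ge0_muleDr; last 2 first.
  - apply: sume_ge0 => k _; rewrite mule_ge0 // lee_fin ltW //.
    by case/andP: (mesh k (ltn_trans (ltn_ord k) ile)).
  - by rewrite mule_ge0 // lee_fin ltW //; case/andP: (mesh i ile).
  rewrite addeA; have [g Ag sch] := scheme i ile.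
  have [gi ga] := acc _ _ (zL _ ile) Ag.
  have /andP[hi _] := mesh i ile.
  apply: le_trans (entropy_step hi _ _ _ gi sch ga) _;
    [exact/Lfun1_integrable/zL|exact/Lfun1_integrable/zL/ltnW|exact/Lfun1_integrable/fL|].
  by rewrite leeD2r // IH // ltnW.
apply: le_trans key _.
rewrite EFinD addeA; apply: leeD.
  apply: le_trans (entropy_L1dist (ms 0%N _) mu0) _ => //.
  by rewrite leeD2l // EFinM lee_wpmul2l // lee_fin.
rewrite EFinM lee_wpmul2l ?lee_fin //; apply: le_trans (ltW source).
rewrite -!(big_mkord xpredT (fun k => (s k.+1 - s k)%:E * L1norm nu (f k.+1))%E).
rewrite [leRHS](big_cat_nat _ ile) //= leeDl //.
rewrite big_nat; apply: sume_ge0 => k /andP[_ kn]; rewrite mule_ge0 // lee_fin ltW //.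
by case/andP: (mesh k kn).
Qed.

Lemma mild_solution_entropy (A : (X -> R) -> (X -> R) -> Prop) (u0 : X -> R)
    (u : R -> X -> R) (t : R) :
  (forall v g, v \in Lfun nu 1 -> A v g ->
    nu.-integrable setT (EFin \o g) /\ (0 <= \int[nu]_x (q (v x) * g x)%:E)%E) ->
  measurable_fun setT u0 -> mild_solution nu A u0 u -> 0 < t ->
  (\int[nu]_x (j (u t x))%:E <= \int[nu]_x (j (u0 x))%:E)%E.
Proof.
move=> acc mu0 [uL _ _ approx] t0; have L0 := entropy_bound_ge0.
apply/lee_addgt0Pr => e e0.
(* The scheme costs $2Le'$ and the passage from its value to [u t] another $Le'$, hence the factor
   3; the added 1 covers [L = 0]. The cap at 1 makes a scheme with horizon [t + 1] reach [t]. *)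
pose e' := Num.min 1 (e / (3 * L + 1)).
have L1 : 0 < 3 * L + 1 by lra.
have e'0 : 0 < e' by rewrite lt_min ltr01 divr_gt0.
have [n [s [z [f [ap _ close]]]]] := approx (t + 1) e' ltac:(lra) e'0.
have [i ile /close tz] : exists2 i, (i < n)%N & s i < t <= s i.+1.
  have tn : t <= s n.
    have /andP[+ _] := approx_end ap; have : e' <= 1 by rewrite ge_min lexx.
    by lra.
  have s0 : s 0%N < t by rewrite (approx_start ap).
  elim: n tn {ap close} => [|m IH] tn; first by move: s0; rewrite ltNge tn.
  have [/IH[i im it]|tm] := leP t (s m); first by exists i => //; rewrite ltnS ltnW.
  by exists m => //; rewrite tm.
have mz k : (k <= n)%N -> measurable_fun setT (z k).
  by move=> kn; apply/measurable_EFinP/(measurable_int nu)/Lfun1_integrable/(approx_z_L1 ap).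
have mut : measurable_fun setT (u t).
  by apply/measurable_EFinP/(measurable_int nu)/Lfun1_integrable/uL/ltW.
apply: le_trans (entropy_L1dist mut (mz _ ile)) _.
apply: le_trans (leeD (approx_solution_entropy acc mu0 ap ile) _) _.
  apply: lee_wpmul2l (tz ile) => //.
rewrite -addeA leeD2l // -EFinM -EFinD lee_fin.
have : e' <= e / (3 * L + 1) by rewrite ge_min lexx orbT.
rewrite ler_pdivlMr //; nra.
Qed.

End entropy.

(** * Truncated powers and excesses as entropies *)

Section entropy_examples.
Context (R : realType).
Implicit Types (a b c M g : R).

Lemma sgr_mul_le a b : Num.sg a * b <= `|b|.
Proof.
by have [_|_|_] := sgrP a; rewrite ?mul0r ?mul1r ?mulN1r ?normr_ge0 ?ler_norm // -normrN ler_norm.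
Qed.

(** Young's inequality for [b] and $a^{g-1}$ with the conjugate exponents $g$ and $g/(g-1)$,
    multiplied by $g$. *)
Lemma powR_tangent g a b : 1 <= g -> 0 <= a -> 0 <= b ->
  a `^ g - b `^ g <= g * a `^ (g - 1) * (a - b).
Proof.
move=> g1 a0 b0; have g0 : 0 < g by lra.
have -> : g * a `^ (g - 1) * (a - b) = g * (a * a `^ (g - 1)) - g * (b * a `^ (g - 1)) by ring.
rewrite mulr_powRB1 //.
(* For [g = 1] the conjugate exponent degenerates, and the claim is an equality. *)
have [->|gN1] := eqVneq g 1; first by rewrite subrr powRr0 !powRr1 //; lra.
have g1' : 0 < g - 1 by rewrite subr_gt0 lt_neqAle eq_sym gN1.
have := @conjugate_powR R b (a `^ (g - 1)) g (g / (g - 1)) b0 (powR_ge0 _ _) g0.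
rewrite divr_gt0 // => /(_ isT); rewrite -powRrM.
have -> : (g - 1) * (g / (g - 1)) = g by field; rewrite gt_eqF.
have -> : (g / (g - 1))^-1 = (g - 1) / g by field; rewrite !gt_eqF.
have -> : g^-1 + (g - 1) / g = 1 by field; rewrite gt_eqF.
move=> /(_ erefl) /(ler_wpM2l (ltW g0)).
have -> : g * (b `^ g / g + a `^ g * ((g - 1) / g)) = b `^ g + a `^ g * (g - 1).
  by field; rewrite gt_eqF.
lra.
Qed.

(* [|a| ^ g] for [|a| <= M], continued by its tangent lines. *)
Definition pow_entropy g M a : R := let m := Num.min `|a| M in
  m `^ g + g * m `^ (g - 1) * (`|a| - m).

Definition pow_entropy_slope g M a : R :=
  Num.sg a * (g * Num.min `|a| M `^ (g - 1)).

Lemma pow_entropy_pair g M : 1 <= g -> 0 <= M ->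
  entropy_pair (pow_entropy g M) (pow_entropy_slope g M) (g * M `^ (g - 1)).
Proof.
move=> g1 M0; have g0 : 0 <= g by lra.
have m0 a : 0 <= Num.min `|a| M by rewrite le_min normr_ge0.
have mM a : Num.min `|a| M <= M by rewrite ge_min lexx orbT.
have ma a : Num.min `|a| M <= `|a| by rewrite ge_min lexx.
have g10 : 0 <= g - 1 by lra.
have pM a : Num.min `|a| M `^ (g - 1) <= M `^ (g - 1) by apply: ge0_ler_powR; rewrite // nnegrE.
split=> [a||a|a b].
- by rewrite addr_ge0 ?powR_ge0 ?mulr_ge0 ?powR_ge0 ?subr_ge0.
- rewrite /pow_entropy normr0 min_l // subrr mulr0 addr0 powR0 //; lra.
- rewrite normrM [X in _ * X]ger0_norm; last by rewrite mulr_ge0 ?powR_ge0.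
  rewrite -[leRHS]mul1r; apply: ler_pM; rewrite ?mulr_ge0 ?powR_ge0 //.
    by rewrite normr_sg lern1 leq_b1.
  by rewrite ler_wpM2l.
rewrite /pow_entropy /pow_entropy_slope /=; set m := Num.min `|a| M; set n := Num.min `|b| M.
(* The three bounds [t], [h1], [h2] add up to the claim. [t] compares the capped moduli; [h1]
   exchanges the slope at [n] for the one at [m] and matters only if [b] exceeds the cap, where the
   slope is largest; [h2] passes from moduli to signed values. *)
have t : m `^ g - n `^ g <= g * m `^ (g - 1) * (m - n) by apply: powR_tangent; rewrite ?m0.
have h1 : g * m `^ (g - 1) * (`|b| - n) <= g * n `^ (g - 1) * (`|b| - n).
  have [bM|Mb] := leP `|b| M; first by rewrite /n min_l // subrr !mulr0.
  have nM : n = M by rewrite /n min_r ?ltW.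
  by apply: ler_wpM2r; rewrite ?subr_ge0 ?ma // ler_wpM2l // nM pM.
have h2 : g * m `^ (g - 1) * (`|a| - `|b|) <= Num.sg a * (g * m `^ (g - 1)) * (a - b).
  have -> : Num.sg a * (g * m `^ (g - 1)) * (a - b) = g * m `^ (g - 1) * (Num.sg a * a - Num.sg a * b) by ring.
  rewrite ler_wpM2l ?mulr_ge0 ?powR_ge0 //.
  by rewrite -normrEsg lerD2l lerN2 sgr_mul_le.
lra.
Qed.

Lemma pow_entropy_le g M a : 1 <= g -> 0 <= M -> pow_entropy g M a <= `|a| `^ g.
Proof.
move=> g1 M0; rewrite /pow_entropy /=; set m := Num.min `|a| M.
have m0 : 0 <= m by rewrite le_min normr_ge0.
have := powR_tangent g1 m0 (normr_ge0 a); lra.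
Qed.

Lemma pow_entropyE g M a : `|a| <= M -> pow_entropy g M a = `|a| `^ g.
Proof. by move=> aM; rewrite /pow_entropy min_l // subrr mulr0 addr0. Qed.

Definition excess M a : R := Num.max (`|a| - M) 0.

Definition excess_slope M a : R := if `|a| <= M then 0 else Num.sg a.

Lemma excess_pair M : 0 <= M -> entropy_pair (excess M) (excess_slope M) 1.
Proof.
move=> M0; split=> [a||a|a b]; rewrite /excess /excess_slope.
- by rewrite le_max lexx orbT.
- by rewrite normr0 max_r //; lra.
- by case: ifP => _; rewrite ?normr0 // normr_sg lern1 leq_b1.
have [aM|Ma] := leP `|a| M.
  by rewrite max_r ?subr_le0 // mul0r sub0r oppr_le0 le_max lexx orbT.
rewrite max_l; last by rewrite subr_ge0 ltW.
rewrite mulrBr -normrEsg.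
have : `|b| - M <= Num.max (`|b| - M) 0 by rewrite le_max lexx.
have := sgr_mul_le a b; lra.
Qed.

End entropy_examples.

(** * From entropy inequalities to norms *)

Section Lfun_entropy.
Context d (X : measurableType d) (R : realType).
Variable nu : {measure set X -> \bar R}.

Lemma Lfun_le_entropy (g : \bar R) (u0 u : X -> R) : (1 <= g)%E ->
  measurable_fun setT u -> u0 \in Lfun nu g ->
  (forall j q L, entropy_pair j q L ->
    (\int[nu]_x (j (u x))%:E <= \int[nu]_x (j (u0 x))%:E)%E) ->
  u \in Lfun nu g /\ ('N[nu]_g[EFin \o u] <= 'N[nu]_g[EFin \o u0])%E.
Proof.
move=> g1 mu /andP[]; rewrite !inE => mu0 fu0 jle.
suff le : ('N[nu]_g[EFin \o u] <= 'N[nu]_g[EFin \o u0])%E.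
  by split=> //; apply/andP; rewrite !inE; split=> //; apply: le_lt_trans le fu0.
rewrite /finite_norm in fu0; rewrite unlock /Lnorm in fu0 *.
case: g g1 fu0 => [g||//]; first rewrite lee_fin.
- move=> g1 _; apply: gt0_ler_poweR.
  + by rewrite invr_ge0; lra.
  + by rewrite in_itv /= leey integral_ge0 // => x _; rewrite poweR_ge0.
  + by rewrite in_itv /= leey integral_ge0 // => x _; rewrite poweR_ge0.
  pose f n x := (pow_entropy g n%:R (u x))%:E.
  have E n := pow_entropy_pair g1 (ler0n R n).
  have mf n : measurable_fun setT (f n).
    by apply/measurable_EFinP; apply: measurableT_comp mu; exact: entropy_measurable (E n).
  have f0 n x : setT x -> (0 <= f n x)%E by rewrite lee_fin (entropy_ge0 (E n)).
  (* At each point the truncated power with cap [n] equals the full power once [n] exceeds $|u(x)|$.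
     Fatou thus recovers $\int |u|^g$, while every truncated integral is bounded by $\int
     |u_0|^g$. *)
  have := fatou nu measurableT mf f0.
  have -> : (\int[nu]_x limn_einf (f ^~ x) = \int[nu]_x (`|(EFin \o u) x| `^ g))%E.
    apply: eq_integral => x _.
    have : f ^~ x @ \oo --> (`|u x| `^ g)%:E.
      apply: cvg_near_cst; exists (Num.truncn `|u x|).+1 => // n /= un.
      rewrite /f pow_entropyE //; apply: ltW; apply: lt_le_trans (truncnS_gt _) _.
      by rewrite ler_nat.
    by move=> /cvg_limn_einf_sup[-> _].
  move=> /le_trans; apply; rewrite limn_einf_lim; apply: lime_le; first exact: is_cvg_einfs.
  apply: nearW => n; apply: (@le_trans _ _ (\int[nu]_x f n x)%E).
    by apply: ereal_inf_lbound; exists n => /=.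
  apply: le_trans (jle _ _ _ (E n)) _; apply: ge0_le_integral => //.
  + by move=> x _; rewrite lee_fin (entropy_ge0 (E n)).
  + by apply/measurable_EFinP; apply: measurableT_comp mu0; exact: entropy_measurable (E n).
  + change (measurable_fun setT (fun x => (`|u0 x| `^ g)%R%:E)).
    apply/measurable_EFinP; apply: measurableT_comp (measurable_powR g) _.
    exact: measurableT_comp.
  by move=> x _; rewrite lee_fin pow_entropy_le.
(* With infinite exponent, the norm is an essential supremum only if the total mass is positive;
   otherwise it is 0 by convention. *)
case: ifPn => // nu0 _ fu0.
rewrite /= in fu0; set M := ess_sup nu (abse \o (EFin \o u0)) in fu0 *.
have M0 : (0 <= M)%E by apply: ess_sup_gee => //; apply: nearW => x /=.
have Mf : M \is a fin_num by rewrite ge0_fin_numE.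
pose m := fine M; have m0 : 0 <= m by exact: fine_ge0.
have E := excess_pair m0.
have mj (v : X -> R) : measurable_fun setT v -> measurable_fun setT (fun x => (excess m (v x))%:E).
  by move=> mv; apply/measurable_EFinP; apply: measurableT_comp mv; exact: entropy_measurable E.
have := jle _ _ _ E.
have -> : (\int[nu]_x (excess m (u0 x))%:E = 0)%E.
  rewrite -(integral0 nu setT); apply: ae_eq_integral => //; first exact: mj.
  have := ess_sup_ge nu (abse \o (EFin \o u0)); apply: filterS => x /= uM _.
  rewrite /excess max_r // subr_le0 -lee_fin fineK //.
move=> j0; apply/ess_supP.
have : (\int[nu]_x `|(excess m (u x))%:E| = 0)%E.
  apply/eqP; rewrite eq_le integral_ge0 // andbT.
  by under eq_integral do rewrite gee0_abs ?lee_fin ?(entropy_ge0 E) //.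
move=> /(ae_eq_integral_abs nu measurableT (mj _ mu)); apply: filterS => x /= /(_ I) [] ux.
rewrite -(fineK Mf) lee_fin -subr_le0 -/m -[leRHS]ux /excess le_max lexx //.
Qed.

End Lfun_entropy.

(** * p-adic characters and Haar measure *)

#[local] Opaque padic_abs padic_frac.

Section padic_arithmetic.
Local Open Scope quotient_scope.
Context (R : realType) (p : nat) (p_pr : prime p).
Local Notation Qp := (Qp p_pr).
Local Notation abs := (padic_abs R).
Local Notation norm := (padic_norm p).
Local Notation pR := (p%:R : R).
Implicit Types (x y z : Qp) (q r : rat).

Lemma prime_gt1r : 1 < pR. Proof. by rewrite ltr1n prime_gt1. Qed.
Lemma prime_gt0r : 0 < pR. Proof. by rewrite ltr0n prime_gt0. Qed.
Hint Resolve prime_gt1r prime_gt0r : core.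

Fact padic_cauchy_cst q : (fun=> q) \in padic_cauchy p.
Proof. by apply/asboolP => e e0; exists 0%N => i j _ _; rewrite subrr padic_norm0. Qed.

(** The same map as [ratr], see [ratr_Qp], but given by constant sequences, whose absolute value can
    be read off at once. *)
Definition Qp_of_rat q : Qp := \pi_Qp (PadicSeq p_pr (padic_cauchy_cst q)).

Fact Qp_of_rat_zmod_morphism : zmod_morphism Qp_of_rat.
Proof. by move=> q r; rewrite -rmorphB; congr (\pi_Qp _); apply: val_inj. Qed.

Fact Qp_of_rat_monoid_morphism : monoid_morphism Qp_of_rat.
Proof.
split; first by rewrite -(rmorph1 \pi_Qp); congr (\pi_Qp _); apply: val_inj.
by move=> q r; rewrite -rmorphM; congr (\pi_Qp _); apply: val_inj.
Qed.

HB.instance Definition _ :=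
  GRing.isZmodMorphism.Build rat Qp Qp_of_rat Qp_of_rat_zmod_morphism.
HB.instance Definition _ :=
  GRing.isMonoidMorphism.Build rat Qp Qp_of_rat Qp_of_rat_monoid_morphism.

Lemma ratr_Qp q : ratr q = Qp_of_rat q.
Proof. by rewrite -{2}(divq_num_den q) fmorph_div !rmorph_int. Qed.

Lemma padic_abs_rat q : abs (Qp_of_rat q) = ratr (norm q).
Proof. by rewrite /Qp_of_rat; apply: padic_abs_lim => /=; exact: cvg_cst. Qed.

Lemma padic_abs1 : abs (1 : Qp) = 1.
Proof. by rewrite -(rmorph1 Qp_of_rat) padic_abs_rat padic_norm1 // rmorph1. Qed.

(** The norms along a Cauchy sequence that is not null are eventually constant, so the completion
    creates no new absolute values. *)
Lemma padic_abs_val x : abs x = 0 \/ exists k : int, abs x = pR ^ k.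
Proof.
elim/quotW: x => u.
have [nu|/padic_seq_norm_cst[c c0 [n un]]] := boolP (u \in @padic_null p p_pr).
  by left; move: nu; rewrite -Qp_pi_eq0 => /eqP ->; rewrite padic_abs0.
have absu : abs (\pi_Qp u) = ratr c.
  by apply: padic_abs_lim; apply: cvg_near_cst; exists n => // i /= /un ->.
right; rewrite absu -(un n (leqnn n)) /padic_norm; case: ifP => [/eqP un0|_].
  by move: c0; rewrite -(un n (leqnn n)) un0 padic_norm0 ltxx.
have pu : (p%:R : rat) \is a GRing.unit by rewrite unitfE pnatr_eq0 -lt0n prime_gt0.
by exists (- padic_val p (u n)); rewrite (rmorphXz _ _ pu) /= ratr_nat.
Qed.

Lemma padic_abs_ge0 x : 0 <= abs x.
Proof. by have [->//|[k ->]] := padic_abs_val x; rewrite exprz_ge0 ?ler0n. Qed.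

Lemma padic_abs_eq0 x : (abs x == 0) = (x == 0).
Proof.
apply/eqP/eqP => [x0|->]; last exact: padic_abs0.
apply/eqP; apply: contraT => xN0; have := padic_absM R x x^-1.
by rewrite x0 mul0r divff // padic_abs1 => /eqP; rewrite oner_eq0.
Qed.

Lemma padic_absV x : abs x^-1 = (abs x)^-1.
Proof.
have [->|x0] := eqVneq x 0; first by rewrite invr0 padic_abs0 invr0.
have a0 : abs x != 0 by rewrite padic_abs_eq0.
by apply: (mulfI a0); rewrite -padic_absM !divff // padic_abs1.
Qed.

Lemma padic_absXz x (k : int) : abs (x ^ k) = abs x ^ k.
Proof.
have hn n : abs (x ^+ n) = abs x ^+ n.
  by elim: n => [|n IH]; rewrite ?expr0 ?padic_abs1 // !exprS padic_absM IH.
by case: k => n; rewrite /= ?hn // NegzE -!exprnN padic_absV hn.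
Qed.

Lemma padic_abs_distC x y : abs (x - y) = abs (y - x).
Proof. by rewrite -padic_absN opprB. Qed.

Lemma padic_absD_le x y (c : R) : abs x <= c -> abs y <= c -> abs (x + y) <= c.
Proof. by move=> xc yc; apply: le_trans (padic_absD _ _ _) _; rewrite ge_max xc. Qed.

Lemma padic_absB_le x y (c : R) : abs x <= c -> abs y <= c -> abs (x - y) <= c.
Proof. by move=> xc yc; apply: padic_absD_le; rewrite ?padic_absN. Qed.

Lemma padic_norm_prime : norm p%:R = p%:R^-1.
Proof.
rewrite /padic_norm pnatr_eq0 gtn_eqF ?prime_gt0 // /padic_val.
have -> : p%:R = p%:~R :> rat by [].
by rewrite numq_int denq_int /= logn1 logn_prime // eqxx.
Qed.

Lemma padic_abs_prime : abs (p%:R : Qp) = pR^-1.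
Proof.
by rewrite -(rmorph_nat Qp_of_rat) padic_abs_rat padic_norm_prime fmorphV rmorph_nat.
Qed.

Lemma padic_abs_primeXz (k : int) : abs ((p%:R : Qp) ^ k) = pR ^ (- k).
Proof. by rewrite padic_absXz padic_abs_prime -exprz_inv. Qed.

(** Discreteness of the value group: it lets indicators of successive balls telescope without a
    remainder. *)
Lemma padic_abs_gap x (k : int) : pR ^ k < abs x -> pR ^ (k + 1) <= abs x.
Proof.
have [->|[m ->]] := padic_abs_val x; first by rewrite ltNge exprz_ge0 ?ler0n.
by rewrite ltr_eXz2l // ler_eXz2l //; lia.
Qed.

Lemma padic_dense x (e : R) : 0 < e -> exists q, abs (x - Qp_of_rat q) < e.
Proof.
elim/quotW: x => u e0; have [d /itvP de] := rat_in_itvoo e0.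
have d0 : 0 < d by rewrite -(ltr0q R) de.
have [n un] := padic_seqP u d0.
exists (u n); rewrite /Qp_of_rat -rmorphB; set v := (u - _).
apply: (@le_lt_trans _ _ (ratr d)); last by rewrite de.
rewrite -(cvg_lim _ (@padic_abs_pi R p p_pr v)) //.
apply: limr_le; first exact: cvgP (@padic_abs_pi R p p_pr v).
by exists n => // i /= ni; rewrite ler_rat ltW // un.
Qed.

Lemma padic_abs_int (a : int) : abs (a%:~R : Qp) <= 1.
Proof.
rewrite -(rmorph_int Qp_of_rat) padic_abs_rat -[leRHS](rmorph1 (@ratr R)) ler_rat.
exact: padic_norm_int.
Qed.

(** Approximate [x] by a rational $q = n/(m p^k)$ with $m$ prime to $p$. From $am + bp^k = 1$ one
    gets $q = na/p^k + nb/m$; the second term is a $p$-adic integer, and reducing $na$ modulo $p^k$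
    changes the first one by an integer. *)
Lemma padic_frac_subproof x : exists r, [/\ 0 <= r < 1,
  exists k, r * p%:R ^+ k \is a Num.int & abs (x - ratr r) <= 1].
Proof.
have [q xq] := padic_dense x ltr01.
have d0 : (0 < `|denq q|)%N by rewrite absz_gt0 denq_neq0.
have [m pm dE] := pfactor_coprime p_pr d0; set k := logn p _ in dE.
have pk0 : (p%:R ^+ k : rat) != 0 by rewrite expf_neq0 // pnatr_eq0 -lt0n prime_gt0.
have m0 : (m%:R : rat) != 0.
  by rewrite pnatr_eq0; apply: contraTneq d0 => m0; rewrite dE m0 mul0n.
have := Bezoutz m%:Z (p ^ k)%N%:Z => -[a [b]].
have -> : gcdz m%:Z (p ^ k)%N%:Z = 1.
  by rewrite /gcdz /= (eqP (_ : coprime m (p ^ k))) // coprime_sym coprimeXl.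
move=> /(congr1 (fun z : int => z%:~R : rat)).
rewrite rmorphD !rmorphM /= -!pmulrn natrX => ab.
have qE : q = (numq q)%:~R / (m%:R * p%:R ^+ k).
  by rewrite -{1}(divq_num_den q) -(gez0_abs (denq_ge0 q)) dE -pmulrn natrM natrX.
pose c := numq q * a; pose P := (p ^ k)%N%:Z.
have P0 : P != 0 by rewrite /P -absz_gt0 /= expn_gt0 prime_gt0.
have PE : P%:~R = p%:R ^+ k :> rat by rewrite -pmulrn natrX.
exists ((c %% P)%Z%:~R / P%:~R); split.
- rewrite divr_ge0 ?ler0z ?modz_ge0 // ltr_pdivrMr; last first.
    by rewrite PE exprn_gt0 // ltr0n prime_gt0.
  by rewrite mul1r ltr_int ltz_mod.
- by exists k; rewrite -PE divfK ?PE // rpred_int.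
rewrite ratr_Qp -(subrK (Qp_of_rat q) x) -addrA; apply: padic_absD_le; first exact: ltW.
rewrite -rmorphB padic_abs_rat -[leRHS](rmorph1 (@ratr R)) ler_rat.
have -> : q - (c %% P)%Z%:~R / P%:~R = (numq q * b)%:~R / m%:R + (c %/ P)%Z%:~R.
  have cE : (c %% P)%Z%:~R = c%:~R - (c %/ P)%Z%:~R * P%:~R :> rat.
    by rewrite -rmorphM -rmorphB /= {2}(divz_eq c P); congr (_%:~R); lia.
  rewrite {1}qE cE /c !rmorphM /= PE.
  rewrite -[in LHS](mulr1 (numq q)%:~R) -[X in _ * X / _]ab.
  by field; rewrite m0 pk0.
apply: le_trans (padic_normD p_pr _ _) _; rewrite ge_max padic_norm_int // andbT.
rewrite padic_normM // padic_normV //.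
have -> : norm m%:R = 1.
  rewrite /padic_norm (negbTE m0) /padic_val.
  have -> : m%:R = m%:~R :> rat by [].
  by rewrite numq_int denq_int /= logn1 logn_coprime.
by rewrite invr1 mulr1 padic_norm_int.
Qed.

Lemma padic_fracP x : let r := padic_frac R x in
  [/\ 0 <= r < 1, exists k, r * p%:R ^+ k \is a Num.int & abs (x - ratr r) <= 1].
Proof.
have [r rP] := padic_frac_subproof x.
exact: (@xgetPex _ 0 [set r : rat | [/\ 0 <= r < 1,
  exists k, r * p%:R ^+ k \is a Num.int & abs (x - ratr r) <= 1]] (ex_intro _ r rP)).
Qed.

(** $\mathbb Z[1/p] \cap \mathbb Z_p = \mathbb Z$: the denominator divides a power of $p$ and is
    prime to $p$. *)
Lemma padic_int_rat q (k : nat) : q * p%:R ^+ k \is a Num.int -> norm q <= 1 ->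
  q \is a Num.int.
Proof.
move=> /intrP[a aE] q1; have pk0 : (p%:R ^+ k : rat) != 0.
  by rewrite expf_neq0 // pnatr_eq0 -lt0n prime_gt0.
have d : (`|denq q| %| p ^ k)%N.
  have qE : q = a%:~R / (p ^ k)%N%:~R by rewrite -pmulrn natrX -aE mulfK.
  have P0 : (p ^ k)%N%:Z != 0 by rewrite -absz_gt0 /= expn_gt0 prime_gt0.
  have E : numq q * (p ^ k)%N = a * denq q.
    apply: (@intr_inj rat); rewrite !rmorphM /= numqE -mulrA [_ * (p^k)%N%:~R]mulrC mulrA.
    by rewrite {1}qE divfK // intr_eq0.
  have : (`|denq q| %| `|numq q| * p ^ k)%N.
    by rewrite -[(p ^ k)%N]/`|(p ^ k)%N%:Z|%N -abszM E abszM dvdn_mull.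
  by rewrite Gauss_dvdr // coprime_sym coprime_num_den.
move: q1; rewrite padic_norm_le1 // => pd; rewrite Qint_def.
move: d => /(dvdn_pfactor _ _ p_pr)[[|m] _ dE].
  by have := denq_ge0 q; move: dE; rewrite expn0; case: (denq q) => //= n ->.
by move: pd; rewrite dE expnS dvdn_mulr.
Qed.

Let ratr_QpBD (r f g : rat) : Qp_of_rat (r - (f + g)) = ratr r - (ratr f + ratr g).
Proof. by rewrite (rmorphB Qp_of_rat) (rmorphD Qp_of_rat) /= -!ratr_Qp. Qed.

Let frac_sub_id (V : comNzRingType) (z x y r f g : V) :
  r - (f + g) = (z - (x + y)) - ((z - r) - ((x - f) + (y - g))).
Proof. by ring. Qed.

(** The difference lies in $\mathbb Z[1/p]$ and in $\mathbb Z_p$. Allowing [z] to differ from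
    [x + y] by a $p$-adic integer yields at once that the character is additive and that it is
    invariant under $\mathbb Z_p$. *)
Lemma padic_frac_cocycle x y z : abs (z - (x + y)) <= 1 ->
  padic_frac R z - (padic_frac R x + padic_frac R y) \is a Num.int.
Proof.
move=> h; have [_ [k1 i1] a1] := padic_fracP x; have [_ [k2 i2] a2] := padic_fracP y.
have [_ [k3 i3] a3] := padic_fracP z.
set f := padic_frac R x in i1 a1 *; set g := padic_frac R y in i2 a2 *.
set r := padic_frac R z in i3 a3 *.
apply: (@padic_int_rat _ (k1 + k2 + k3)%N).
  have ip n : (p%:R ^+ n : rat) \is a Num.int by rewrite rpredX // rpred_nat.
  rewrite !exprD.
  have -> : (r - (f + g)) * (p%:R ^+ k1 * p%:R ^+ k2 * p%:R ^+ k3) =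
    r * p%:R ^+ k3 * (p%:R ^+ k1 * p%:R ^+ k2) -
    (f * p%:R ^+ k1 * (p%:R ^+ k2 * p%:R ^+ k3) +
     g * p%:R ^+ k2 * (p%:R ^+ k1 * p%:R ^+ k3)) by ring.
  by apply: rpredB; last apply: rpredD; apply: rpredM => //; apply: rpredM.
rewrite -(ler_rat R) (rmorph1 (@ratr R)) -padic_abs_rat.
rewrite ratr_QpBD.
rewrite (frac_sub_id z x y (ratr r) (ratr f) (ratr g)).
exact: (padic_absB_le h (padic_absB_le a3 (padic_absD_le a1 a2))).
Qed.

Definition padic_angle x : R := 2 * pi * ratr (padic_frac R x).

Lemma trig_angleDint (a : R) (n : int) :
  cos (a + 2 * pi * n%:~R) = cos a /\ sin (a + 2 * pi * n%:~R) = sin a.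
Proof.
have P (m : nat) (b : R) : cos (b + 2 * pi * m%:R) = cos b /\ sin (b + 2 * pi * m%:R) = sin b.
  elim: m => [|m [<- <-]]; first by rewrite mulr0 addr0.
  have -> : b + 2 * pi * m.+1%:R = b + 2 * pi * m%:R + pi *+ 2.
    by rewrite -natr1 -[pi *+ 2]mulr_natl; ring.
  by rewrite cosD2pi sinD2pi.
case: n => m; first by rewrite -pmulrn.
have := P m.+1 (a + 2 * pi * (Negz m)%:~R).
by rewrite NegzE mulrNz -pmulrn mulrN subrK => -[-> ->].
Qed.

Let trig_cocycle (r s t : R) (n : int) : t - (r + s) = n%:~R ->
  cos (2 * pi * t) = cos (2 * pi * r + 2 * pi * s) /\
  sin (2 * pi * t) = sin (2 * pi * r + 2 * pi * s).
Proof.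
move=> E; have -> : 2 * pi * t = 2 * pi * r + 2 * pi * s + 2 * pi * n%:~R.
  by rewrite -E; ring.
exact: trig_angleDint.
Qed.

Let trig_trivial (a b : R) : cos a = 1 -> sin a = 0 ->
  cos (a + b) = cos b /\ sin (a + b) = sin b.
Proof. by move=> c s; rewrite cosD sinD c s !mul1r !mul0r subr0 add0r. Qed.

Lemma padic_angle_cocycle x y z : abs (z - (x + y)) <= 1 ->
  cos (padic_angle z) = cos (padic_angle x + padic_angle y) /\
  sin (padic_angle z) = sin (padic_angle x + padic_angle y).
Proof.
move=> /padic_frac_cocycle /intrP[n nE].
have E : n%:~R = ratr (padic_frac R z) - (ratr (padic_frac R x) + ratr (padic_frac R y)) :> R.
  by rewrite -(ratr_int R n) -nE (rmorphB (@ratr R)) (rmorphD (@ratr R)).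
exact: trig_cocycle (esym E).
Qed.

Lemma padic_angle_int x : abs x <= 1 ->
  cos (padic_angle x) = 1 /\ sin (padic_angle x) = 0.
Proof.
have c0 : cos (padic_angle 0) = 1 /\ sin (padic_angle 0) = 0.
  have h : abs (0 - (0 + 0) : Qp) <= 1 by rewrite (addr0 (0 : Qp)) (subr0 (0 : Qp)) padic_abs0.
  have := padic_frac_cocycle h.
  have -> r : r - (r + r) = - r :> rat by ring.
  rewrite rpredN => /intrP[n nE]; rewrite /padic_angle nE ratr_int.
  by have := trig_angleDint 0 n; rewrite add0r cos0 sin0.
move=> x1.
have h : abs (x - (0 + 0)) <= 1 by rewrite (addr0 (0 : Qp)) (subr0 x).
by have [-> ->] := padic_angle_cocycle h; rewrite cosD sinD !c0.1 !c0.2 !mul1r !mul0r subr0 addr0.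
Qed.

Lemma padic_angle_eq x y : abs (x - y) <= 1 ->
  cos (padic_angle x) = cos (padic_angle y) /\ sin (padic_angle x) = sin (padic_angle y).
Proof.
move=> xy; have [c s] := padic_angle_int xy.
have h : abs (x - (x - y + y)) <= 1 by rewrite (subrK y x) (subrr x) padic_abs0.
have [C S] := trig_trivial (padic_angle y) c s; have [Cx Sx] := padic_angle_cocycle h.
by split; [exact: etrans Cx C|exact: etrans Sx S].
Qed.

(** The fractional part $r$ lies strictly between 0 and 1, so $\sin(\pi r) > 0$ and $\cos(2\pi r) =
    1 - 2\sin^2(\pi r) < 1$. *)
Lemma padic_angle_nontrivial x : 1 < abs x -> cos (padic_angle x) != 1.
Proof.
move=> x1; have [/andP[r0 r1] _ xr] := padic_fracP x.
have rpos : 0 < ratr (padic_frac R x) :> R.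
  rewrite ltr0q lt_neqAle r0 andbT; apply: contraTneq x1 => r00.
  by move: xr; rewrite -r00 ratr_Qp (rmorph0 Qp_of_rat) (subr0 x) -leNgt.
have r1' : ratr (padic_frac R x) < 1 :> R by rewrite -[ltRHS](rmorph1 (@ratr R)) ltr_rat.
rewrite /padic_angle; set r := ratr _ in rpos r1' *.
have -> : 2 * pi * r = (pi * r) *+ 2 by rewrite -[RHS]mulr_natl mulrA.
rewrite cos_mulr2n -[X in _ *+ 2 - X](cos2Dsin2 (pi * r)).
have s0 : 0 < sin (pi * r).
  by apply: sin_gt0_pi; rewrite mulr_gt0 ?pi_gt0 //= gtr_pMr ?pi_gt0.
have := cos2Dsin2 (pi * r); have : 0 < sin (pi * r) ^+ 2 by rewrite exprn_gt0.
move=> h1 h2; apply/negP => /eqP; rewrite mulr2n; lra.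
Qed.

End padic_arithmetic.

(** * Haar measure of balls and discs *)

Section haar_measure.
Context (R : realType) (p : nat) (p_pr : prime p).
Local Notation Qp := (Qp p_pr).
Local Notation abs := (padic_abs R).
Local Notation pR := (p%:R : R).
Local Notation ball := (@padic_ball R p p_pr).
Implicit Types (x y a : Qp) (k : int).

Lemma padic_open_measurable (U : set (Qp_borel R p_pr)) :
  (forall x : Qp, U x -> exists2 r : R, 0 < r & forall y : Qp, abs (y - x) < r -> U y) ->
  measurable U.
Proof. by move=> h; exact: sub_sigma_algebra. Qed.

Lemma measurable_locally_constant (f : Qp -> R) :
  (forall x, exists2 r : R, 0 < r & forall y, abs (y - x) < r -> f y = f x) ->
  measurable_fun setT (f : Qp_borel R p_pr -> R).
Proof.
move=> h _ Y mY; rewrite setTI; apply: padic_open_measurable => x Yx.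
by have [r r0 fr] := h x; exists r => // y /fr yx; rewrite /preimage /= yx.
Qed.

Definition padic_disc a (c : R) : set (Qp_borel R p_pr) := [set x : Qp | abs (x - a) <= c].

Lemma padic_discE a k : padic_disc a (pR ^ k) = [set a + y | y in ball k].
Proof.
apply/seteqP; split=> [x xa|_ [y yk <-]].
  by exists (x - a); [exact: xa|rewrite addrC (subrK a x)].
by rewrite /padic_disc /= addrAC (subrr a) (add0r y).
Qed.

Lemma measurable_padic_disc a (c : R) : 0 < c -> measurable (padic_disc a c).
Proof.
move=> c0; apply: padic_open_measurable => x xa; exists c => // y yx.
rewrite /padic_disc /= -(subrK x y) -(addrA (y - x) x (- a)).
by apply: padic_absD_le => //; exact: ltW.
Qed.

Lemma padic_disc_triv x y a (c : R) : padic_disc a c x -> padic_disc a c y -> abs (x - y) <= c.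
Proof.
move=> xa ya; rewrite -(subrK a x) -(addrA (x - a) a (- y)).
by apply: padic_absD_le => //; rewrite padic_abs_distC.
Qed.

(** The product sigma-algebra is generated by rectangles, so separability is needed: by the
    ultrametric inequality this set is the countable union of the squares of discs centred at
    rationals. It gives the joint measurability of $Z(t, x - y)$. *)
Lemma measurable_padic_diag (c : R) : 0 < c ->
  measurable [set z : Qp_borel R p_pr * Qp_borel R p_pr | abs ((z.1 : Qp) - z.2) <= c].
Proof.
move=> c0.
have -> : [set z : Qp_borel R p_pr * Qp_borel R p_pr | abs ((z.1 : Qp) - z.2) <= c] =
    \bigcup_(q : rat) (padic_disc (Qp_of_rat p_pr q) c `*` padic_disc (Qp_of_rat p_pr q) c).
  apply/seteqP; split=> [[x y] /= xy|[x y] [q _] [/= xq yq]]; last exact: padic_disc_triv xq yq.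
  have [q yq] := padic_dense y c0; exists q => //; split; last exact: ltW.
  rewrite /padic_disc /= -(subrK y x) -(addrA (x - y) y (- _)).
  by apply: padic_absD_le => //; exact: ltW.
apply: bigcupT_measurable_rat => q; apply: measurableX; exact: measurable_padic_disc.
Qed.

Context (mu : {measure set (Qp_borel R p_pr) -> \bar R}).
Hypothesis mu_haar : normalized_haar mu.

Lemma haar_disc a k : mu (padic_disc a (pR ^ k)) = mu (ball k).
Proof. by rewrite padic_discE (haar_translation mu_haar) //; exact: measurable_padic_ball. Qed.

(** Multiplying by $p^k$ reduces to $|y|_p \le p$, where the fractional part is $i/p$ with $0 \le i
    < p$: the leading digit of [x]. *)
Lemma padic_digit x k : abs x <= pR ^ (k + 1) ->
  exists2 i, (i < p)%N & abs (x - i%:R * (p%:R : Qp) ^ (- k - 1)) <= pR ^ k.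
Proof.
have p0 : (p%:R : rat) != 0 by rewrite pnatr_eq0 -lt0n prime_gt0.
have pQ : (p%:R : Qp) != 0.
  by rewrite -(padic_abs_eq0 R) padic_abs_prime invr_eq0 gt_eqF ?(prime_gt0r R p_pr).
move=> xk; pose y := x * (p%:R : Qp) ^ k.
have yp : abs y <= pR.
  rewrite padic_absM padic_abs_primeXz -(expr1z pR).
  apply: le_trans (ler_wpM2r _ xk) _; first by rewrite exprz_ge0 ?ler0n.
  by rewrite -expfzDr ?gt_eqF ?(prime_gt0r R p_pr) // addrAC subrr add0r.
have [/andP[r0 r1] [n rn] yr] := padic_fracP R y; set r := padic_frac R y in r0 r1 rn yr.
have rp : abs (ratr r : Qp) <= pR.
  have -> : (ratr r : Qp) = y - (y - ratr r) by rewrite opprB addrC (subrK y).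
  by apply: padic_absB_le => //; apply: le_trans yr _; exact: ltW (prime_gt1r R p_pr).
have : r * p%:R \is a Num.int.
  apply: (padic_int_rat p_pr (k := n)); first by rewrite mulrAC rpredM // rpred_nat.
  rewrite -(ler_rat R) (rmorph1 (@ratr R)) -(padic_abs_rat R p_pr) (rmorphM (Qp_of_rat p_pr)) padic_absM /=.
  rewrite -ratr_Qp (rmorph_nat (Qp_of_rat p_pr)) padic_abs_prime.
  by rewrite ler_pdivrMr ?(prime_gt0r R p_pr) // mul1r.
move=> /intrP[i iE].
have i0 : 0 <= i by rewrite -(ler0z rat) -iE mulr_ge0 // ler0n.
case: i i0 iE => // i _; rewrite -pmulrn => /esym iE.
exists i.
  by rewrite -(ltr_nat rat) iE gtr_pMl // ltr0n prime_gt0.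
have rE : (ratr r : Qp) = i%:R * (p%:R : Qp)^-1.
  have H : Qp_of_rat p_pr r * p%:R = i%:R.
    rewrite -(rmorph_nat (Qp_of_rat p_pr) p) -(rmorphM (Qp_of_rat p_pr)) -iE.
    exact: (rmorph_nat (Qp_of_rat p_pr)).
  by rewrite ratr_Qp -H (mulfK pQ).
have -> : x - i%:R * (p%:R : Qp) ^ (- k - 1) = (y - ratr r) * (p%:R : Qp) ^ (- k).
  rewrite rE /y (mulrBl ((p%:R : Qp) ^ (- k))) -(mulrA x) -(mulrA (i%:R : Qp)).
  rewrite -(expfzDr _ _ pQ) subrr (expr0z (p%:R : Qp)) (mulr1 x).
  by rewrite -(exprN1 (p%:R : Qp)) -(expfzDr _ _ pQ) (addrC (-1) (- k)).
rewrite padic_absM padic_abs_primeXz opprK -[leRHS]mul1r.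
by apply: ler_wpM2r => //; rewrite exprz_ge0 ?ler0n.
Qed.

(** The larger ball is the disjoint union of $p$ translates of the smaller one, indexed by the
    leading digit. *)
Lemma haar_ball_succ k : mu (ball (k + 1)) = (p%:R%:E * mu (ball k))%E.
Proof.
pose c i : Qp := i%:R * (p%:R : Qp) ^ (- k - 1).
have pk0 : 0 < pR ^ k by rewrite exprz_gt0 ?(prime_gt0r R p_pr).
have mC i := measurable_padic_disc (c i) pk0.
pose F i := if (i < p)%N then padic_disc (c i) (pR ^ k) else set0.
have mF i : measurable (F i) by rewrite /F; case: ifP.
(* The difference [j - i] is prime to $p$, so the two centres are at distance exactly $p^{k+1}$, too
   far apart for discs of radius $p^k$ to meet. *)
have disj i j : (i < j)%N -> (j < p)%N -> padic_disc (c i) (pR ^ k) `&` padic_disc (c j) (pR ^ k) = set0.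
  move=> ij jp; apply/seteqP; split=> // x [/= xi xj].
  have : abs (c j - c i) <= pR ^ k.
    rewrite -(subrK x (c j)) -(addrA (c j - x) x (- c i)).
    by apply: padic_absD_le => //; rewrite padic_abs_distC.
  rewrite /c -(mulrBl ((p%:R : Qp) ^ (- k - 1))) padic_absM padic_abs_primeXz.
  have -> : - (- k - 1) = k + 1 by lia.
  rewrite -(natrB _ (ltnW ij)) -(rmorph_nat (Qp_of_rat p_pr)) padic_abs_rat.
  rewrite /padic_norm pnatr_eq0 subn_eq0 leqNgt ij /=.
  have -> : (j - i)%:R = (j - i)%N%:~R :> rat by [].
  rewrite /padic_val numq_int denq_int /= logn1 logn_coprime; last first.
    by rewrite prime_coprime // gtnNdvd ?subn_gt0 // (leq_ltn_trans (leq_subr _ _) jp).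
  rewrite subr0 oppr0 expr0z (rmorph1 (@ratr R)) mul1r leNgt ltr_eXz2l ?(prime_gt1r R p_pr) //.
  by rewrite ltzD1 lexx.
have tF : trivIset setT F.
  apply/trivIsetP => i j _ _ ij; rewrite /F.
  case: ifPn => [ip|]; last by rewrite set0I.
  case: ifPn => [jp|]; last by rewrite setI0.
  by move: ij; rewrite neq_ltn => /orP[ij|ij]; [exact: disj|rewrite setIC; exact: disj].
have -> : ball (k + 1) = \big[setU/set0]_(i < p) F i.
  rewrite -bigcup_mkord; apply/seteqP; split=> [x xk|x [i /= ip]].
    by have [i ip xi] := padic_digit xk; exists i => //; rewrite /F ip.
  rewrite /F ip => xi; rewrite /padic_ball /= -(subrK (c i) x).
  apply: padic_absD_le.
    by apply: le_trans xi _; rewrite ler_eXz2l ?(prime_gt1r R p_pr) // lerDl.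
  rewrite /c padic_absM padic_abs_primeXz.
  have -> : - (- k - 1) = k + 1 by lia.
  rewrite -[leRHS]mul1r; apply: ler_wpM2r; first by rewrite exprz_ge0 ?ler0n.
  exact: (padic_abs_int R p_pr i).
rewrite measure_bigsetU // (eq_bigr (fun=> mu (ball k))); last first.
  move=> i _; have ip := ltn_ord i.
  have -> : F i = padic_disc (c i) (pR ^ k) by rewrite /F ip.
  exact: haar_disc.
by rewrite sumr_const card_ord mule_natl.
Qed.

Lemma haar_ballE k : mu (ball k) = (pR ^ k)%:E.
Proof.
have p0 : pR != 0 by rewrite gt_eqF ?(prime_gt0r R p_pr).
elim/int_rect: k => [|n IH|n IH]; first by rewrite (haar_Zp mu_haar) expr0z.
- by rewrite -addn1 PoszD haar_ball_succ IH -EFinM (expfzDr _ _ p0) expr1z mulrC.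
- have := haar_ball_succ (- n.+1%:Z); rewrite (_ : - n.+1%:Z + 1 = - n%:Z); last by lia.
  rewrite IH => h; have : (p%:R^-1%:E * (pR ^ (- n%:Z))%:E)%E = mu (ball (- n.+1%:Z)).
    by rewrite h muleA -EFinM mulVf // mul1e.
  move=> <-; rewrite -EFinM; congr EFin.
  by rewrite -exprN1 -(expfzDr _ _ p0); congr (_ ^ _); lia.
Qed.

Lemma haar_discE a k : mu (padic_disc a (pR ^ k)) = (pR ^ k)%:E.
Proof. by rewrite haar_disc haar_ballE. Qed.

End haar_measure.

(** * Integrals of characters over balls *)

Section fourier.
Context (R : realType) (p : nat) (p_pr : prime p).
Local Notation Qp := (Qp p_pr).
Local Notation abs := (padic_abs R).
Local Notation pR := (p%:R : R).
Local Notation ball := (@padic_ball R p p_pr).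
Context (mu : {measure set (Qp_borel R p_pr) -> \bar R}).
Hypothesis mu_haar : normalized_haar mu.
Implicit Types (x y a : Qp) (k : int).

Let p_gt0 : 0 < pR := prime_gt0r R p_pr.
Let p_gt1 : 1 < pR := prime_gt1r R p_pr.

Lemma measurable_padic_translate a :
  measurable_fun setT (fun x : Qp_borel R p_pr => (a + (x : Qp) : Qp_borel R p_pr)).
Proof.
apply: (@measurability _ _ (Qp_borel R p_pr) (Qp_borel R p_pr) setT _ (padic_open R (p_pr := p_pr))) => // _ [U oU <-].
rewrite setTI; apply: padic_open_measurable => x /= /oU [r r0 rU].
exists r => // y yx; apply: rU.
by rewrite (addrC a y) (addrKA a y x).
Qed.

Lemma haar_integral_translate a (D : set (Qp_borel R p_pr)) (f : Qp -> R) :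
  measurable D -> measurable_fun setT (f : Qp_borel R p_pr -> R) ->
  (forall x : Qp, D x -> D (a + x)) -> (forall x : Qp, D (a + x) -> D x) ->
  mu.-integrable D (fun x : Qp_borel R p_pr => (f (a + (x : Qp)))%:E) ->
  (\int[mu]_(x in D) f x)%R = (\int[mu]_(x in D) f (a + (x : Qp)))%R.
Proof.
move=> mD mf D1 D2 fi; rewrite /Rintegral; congr fine.
pose tau (x : Qp_borel R p_pr) : Qp_borel R p_pr := a + (x : Qp).
have mtau : measurable_fun setT tau := measurable_padic_translate a.
have DE : tau @^-1` D = D by apply/seteqP; split=> [x /D2|x /D1].
transitivity (\int[pushforward mu tau]_(x in D) (f x)%:E)%E.
  apply: eq_measure_integral => A mA _; rewrite /pushforward.
  have mtA : measurable (tau @^-1` A) by have := mtau measurableT A mA; rewrite setTI.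
  rewrite -[RHS](haar_translation mu_haar a mtA).
  congr (mu _); apply/seteqP; split=> [x Ax|_ [y ? <-]//].
  by exists (x - a); rewrite /preimage /tau /= (addrC a (x - a)) (subrK a x).
by rewrite (integral_pushforward mtau) ?DE //; exact/measurable_EFinP.
Qed.

Lemma measurable_padic_angle (f : R -> R) x :
  (forall y z, abs (y - z) <= 1 -> f (padic_angle R y) = f (padic_angle R z)) ->
  measurable_fun setT (fun xi : Qp_borel R p_pr => f (padic_angle R ((xi : Qp) * x))).
Proof.
move=> h; apply: measurable_locally_constant => y.
have x1 : 0 < abs x + 1 by rewrite ltr_wpDl // padic_abs_ge0.
(* At this radius the product with [x] moves by at most 1, hence within a coset of $\mathbb Z_p$;
   the added 1 covers [x = 0]. *)
exists (abs x + 1)^-1; first by rewrite invr_gt0.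
move=> z zy; apply: h; rewrite -(mulrBl x z y) padic_absM.
apply: (@le_trans _ _ ((abs x + 1)^-1 * (abs x + 1))); last by rewrite mulVf // gt_eqF.
by apply: ler_pM; rewrite ?padic_abs_ge0 //; [exact: ltW|rewrite lerDl].
Qed.

Lemma measurable_cos_padic x :
  measurable_fun setT (fun xi : Qp_borel R p_pr => cos (padic_angle R ((xi : Qp) * x))).
Proof. by apply: (measurable_padic_angle (f := cos)) => y z /padic_angle_eq[]. Qed.

Lemma measurable_sin_padic x :
  measurable_fun setT (fun xi : Qp_borel R p_pr => sin (padic_angle R ((xi : Qp) * x))).
Proof. by apply: (measurable_padic_angle (f := sin)) => y z /padic_angle_eq[]. Qed.

Lemma integrable_ball (f : Qp -> R) k :
  measurable_fun setT (f : Qp_borel R p_pr -> R) -> (forall x, `|f x| <= 1) ->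
  mu.-integrable (ball k : set (Qp_borel R p_pr)) (fun x : Qp_borel R p_pr => (f x)%:E).
Proof.
move=> mf f1; apply: measurable_bounded_integrable.
- exact: measurable_padic_ball.
- by rewrite haar_ballE // ltry.
- exact: measurable_funTS.
by exists 1; split=> // M M1 x _; apply: le_trans (f1 x) (ltW M1).
Qed.

Lemma norm_cos_le1 (t : R) : `|cos t| <= 1.
Proof. by rewrite ler_norml cos_geN1 cos_le1. Qed.

Lemma norm_sin_le1 (t : R) : `|sin t| <= 1.
Proof. by rewrite ler_norml sin_geN1 sin_le1. Qed.

Lemma integral_cos_ball_trivial k x : abs x <= pR ^ (- k) ->
  (\int[mu]_(xi in ball k) cos (padic_angle R ((xi : Qp) * x)))%R = pR ^ k.
Proof.
move=> xk.
transitivity (\int[mu]_(xi in ball k) (1 : R))%R.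
  apply: eq_Rintegral => xi; rewrite inE => xik.
  apply: (padic_angle_int _).1; rewrite padic_absM.
  apply: (@le_trans _ _ (pR ^ k * pR ^ (- k))); first by apply: ler_pM; rewrite ?padic_abs_ge0.
  by rewrite -expfzDr ?gt_eqF // subrr expr0z.
by rewrite Rintegral_cst ?haar_ballE ?mul1r //; exact: measurable_padic_ball.
Qed.

(* Translating by [a] in the ball rotates the vector (int cos, int sin) by the
   angle of [a x], which is not a multiple of 2 pi, so this vector is 0. *)
Lemma integral_cos_ball_nontrivial k x : pR ^ (- k) < abs x ->
  (\int[mu]_(xi in ball k) cos (padic_angle R ((xi : Qp) * x)))%R = 0.
Proof.
(* [a] has the largest absolute value allowed in the ball, so translation by it preserves the ball
   while [a * x] leaves $\mathbb Z_p$. *)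
move=> xk; pose a : Qp := (p%:R : Qp) ^ (- k).
have ak : abs a = pR ^ k by rewrite padic_abs_primeXz opprK.
have ax : cos (padic_angle R (a * x)) != 1.
  apply: padic_angle_nontrivial; rewrite padic_absM ak -[ltLHS](expr0z pR) -(subrr k).
  by rewrite expfzDr ?gt_eqF // ltr_pM2l // exprz_gt0.
have mB : measurable (ball k : set (Qp_borel R p_pr)) by exact: measurable_padic_ball.
have [mc ms] := (measurable_cos_padic x, measurable_sin_padic x).
have ci := integrable_ball k mc (fun _ => norm_cos_le1 _).
have si := integrable_ball k ms (fun _ => norm_sin_le1 _).
set C := (\int[mu]_(xi in ball k) cos (padic_angle R ((xi : Qp) * x)))%R.
pose S := (\int[mu]_(xi in ball k) sin (padic_angle R ((xi : Qp) * x)))%R.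
set c := cos _ in ax; pose s := sin (padic_angle R (a * x)).
have B1 xi : ball k xi -> ball k (a + xi).
  by move=> xik; apply: padic_absD_le => //; rewrite ak.
have B2 xi : ball k (a + xi) -> ball k xi.
  move=> xik; rewrite -(addrK a xi) (addrC xi a).
  by apply: padic_absB_le => //; rewrite ak.
have angle xi : cos (padic_angle R ((a + xi) * x)) =
      c * cos (padic_angle R (xi * x)) - s * sin (padic_angle R (xi * x)) /\
    sin (padic_angle R ((a + xi) * x)) =
      s * cos (padic_angle R (xi * x)) + c * sin (padic_angle R (xi * x)).
  have h : abs ((a + xi) * x - (a * x + xi * x)) <= 1.
    by rewrite (mulrDl a xi x) (subrr (a * x + xi * x)) padic_abs0.
  have [e1 e2] := padic_angle_cocycle h.
  by split; [exact: etrans e1 (cosD _ _)|exact: etrans e2 (sinD _ _)].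
have mtr (f : Qp -> R) : measurable_fun setT (f : Qp_borel R p_pr -> R) ->
    measurable_fun setT (fun xi : Qp_borel R p_pr => f (a + (xi : Qp))).
  by move=> mf; exact: (measurableT_comp mf (measurable_padic_translate a)).
have EC : C = c * C - s * S.
  rewrite {1}/C (haar_integral_translate mB mc B1 B2); last first.
    by apply: (integrable_ball k (mtr _ mc)) => xi; exact: norm_cos_le1.
  under eq_Rintegral do rewrite (angle _).1.
  rewrite RintegralB //; [|exact: (integrableZl mB c ci)|exact: (integrableZl mB s si)].
  by rewrite !RintegralZl.
have ES : S = s * C + c * S.
  rewrite {1}/S (haar_integral_translate mB ms B1 B2); last first.
    by apply: (integrable_ball k (mtr _ ms)) => xi; exact: norm_sin_le1.
  under eq_Rintegral do rewrite (angle _).2.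
  rewrite RintegralD //; [|exact: (integrableZl mB s ci)|exact: (integrableZl mB c si)].
  by rewrite !RintegralZl.
(* Eliminating [S] from the two rotation equations; the factor vanishes only if [c = 1], which [ax]
   excludes. *)
have : ((1 - c) ^+ 2 + s ^+ 2) * C = 0.
  have -> : ((1 - c) ^+ 2 + s ^+ 2) * C = (1 - c) * (C - (c * C - s * S)) - s * (S - (s * C + c * S)) by ring.
  by rewrite -EC -ES !subrr !mulr0 subrr.
move=> /eqP; rewrite mulf_eq0 => /orP[|/eqP//].
rewrite paddr_eq0 ?sqr_ge0 // sqrf_eq0 subr_eq0 eq_sym => /andP[/eqP c1 _].
by rewrite c1 eqxx in ax.
Qed.

End fourier.

(** * The heat kernel *)

Section radial_fourier.
Context (R : realType) (p : nat) (p_pr : prime p).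
Local Notation Qp := (Qp p_pr).
Local Notation abs := (padic_abs R).
Local Notation pR := (p%:R : R).
Local Notation ball := (@padic_ball R p p_pr).
Context (mu : {measure set (Qp_borel R p_pr) -> \bar R}).
Hypothesis mu_haar : normalized_haar mu.
Variables (psi : R -> R) (b : int) (M : R).
Hypothesis psi_ge0 : forall r, 0 <= psi r.
Hypothesis psi_noninc : forall r s, 0 <= r -> r <= s -> psi s <= psi r.
Hypothesis psi_cvg0 : psi (pR ^ (b - n%:Z)) @[n --> \oo] --> psi 0.
Hypothesis psi_cvgy : psi (pR ^ (b + n%:Z)) @[n --> \oo] --> (0 : R).
Implicit Types (x y xi : Qp) (k : int).

Let p_gt0 : 0 < pR := prime_gt0r R p_pr.
Let p_gt1 : 1 < pR := prime_gt1r R p_pr.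
Let pX_gt0 k : 0 < pR ^ k. Proof. exact: exprz_gt0. Qed.
Let pXD k l : pR ^ (k + l) = pR ^ k * pR ^ l.
Proof. by rewrite expfzDr // gt_eqF. Qed.
Let pX_le k l : (pR ^ k <= pR ^ l) = (k <= l).
Proof. exact: ler_eXz2l. Qed.

Definition radial_weight k : R := psi (pR ^ k) - psi (pR ^ (k + 1)).
Local Notation w := radial_weight.

Hypothesis weight_sum_le : forall K : nat,
  \sum_(i < K) (w (b + i%:Z) * pR ^ (b + i%:Z) +
                w (b - 1 - i%:Z) * pR ^ (b - 1 - i%:Z)) <= M.

Lemma radial_weight_ge0 k : 0 <= w k.
Proof.
by rewrite subr_ge0; apply: psi_noninc; [exact: ltW|rewrite pX_le lerDl].
Qed.

Let indic_term_ge0 k l x : 0 <= w k * \1_(ball l) x.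
Proof. by rewrite mulr_ge0 ?radial_weight_ge0 // indicE ler0n. Qed.

Let indic_term_pX_ge0 k l x : 0 <= w k * pR ^ k * \1_(ball l) x.
Proof. by rewrite mulr_ge0 ?mulr_ge0 ?radial_weight_ge0 ?(ltW (pX_gt0 _)) // indicE ler0n. Qed.

(** A single [K] truncates the sum over all integers $k$ at both ends, to $b - K \le k < b + K$. The
    base [b] will be $-N$, where the transformed balls $B_{-k}$ stop containing $B_N$ as $k$
    grows. *)
Definition radial_layers (K : nat) xi : R :=
  \sum_(i < K) (w (b + i%:Z) * \1_(ball (b + i%:Z)) xi +
                w (b - 1 - i%:Z) * \1_(ball (b - 1 - i%:Z)) xi).

Definition radial_transform (K : nat) x : R :=
  \sum_(i < K) (w (b + i%:Z) * pR ^ (b + i%:Z) * \1_(ball (- (b + i%:Z))) x +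
    w (b - 1 - i%:Z) * pR ^ (b - 1 - i%:Z) * \1_(ball (- (b - 1 - i%:Z))) x).

(** Outside the ball, the gap between absolute values makes both maxima equal to [abs xi], so the
    difference vanishes as the indicator does. In this form the layers telescope. *)
Lemma radial_layer k xi : w k * \1_(ball k) xi =
  psi (Num.max (abs xi) (pR ^ k)) - psi (Num.max (abs xi) (pR ^ (k + 1))).
Proof.
have kk1 : pR ^ k <= pR ^ (k + 1) by rewrite pX_le lerDl.
rewrite indicE; have [xk|] := boolP (xi \in ball k).
  rewrite inE in xk; rewrite mulr1 /w max_r // max_r //; exact: le_trans xk kk1.
rewrite notin_setE /padic_ball /= => /negP; rewrite -ltNge => kx.
by rewrite mulr0 max_l ?ltW // max_l ?subrr //; exact: padic_abs_gap.
Qed.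

Lemma radial_layersE K xi : radial_layers K xi =
  psi (Num.max (abs xi) (pR ^ (b - K%:Z))) - psi (Num.max (abs xi) (pR ^ (b + K%:Z))).
Proof.
rewrite /radial_layers; elim: K => [|K IH]; first by rewrite big_ord0 oppr0 subrr.
rewrite big_ord_recr /= IH !radial_layer.
have -> : b - 1 - K%:Z + 1 = b - K%:Z by lia.
have -> : b + K%:Z + 1 = b + K.+1%:Z by lia.
have -> : b - 1 - K%:Z = b - K.+1%:Z by lia.
lra.
Qed.

Lemma radial_layers_ge0 K xi : 0 <= radial_layers K xi.
Proof. by apply: sumr_ge0 => i _; rewrite addr_ge0. Qed.

Lemma radial_transform_ge0 K x : 0 <= radial_transform K x.
Proof. by apply: sumr_ge0 => i _; rewrite addr_ge0. Qed.

Lemma radial_layers_le K xi : radial_layers K xi <= psi (abs xi).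
Proof.
rewrite radial_layersE; apply: le_trans (_ : psi (Num.max (abs xi) (pR ^ (b - K%:Z))) <= _).
  by rewrite gerBl.
by apply: psi_noninc; rewrite ?padic_abs_ge0 // le_max lexx.
Qed.

Lemma radial_transform_le K x : radial_transform K x <= M.
Proof.
apply: le_trans (weight_sum_le K); apply: ler_sum => i _.
by apply: lerD; rewrite -[leRHS]mulr1 ler_wpM2l ?mulr_ge0 ?radial_weight_ge0
  ?(ltW (pX_gt0 _)) // indicE lern1 leq_b1.
Qed.

Lemma radial_layers_nd xi : {homo radial_layers ^~ xi : m n / (m <= n)%N >-> m <= n}.
Proof.
apply/nondecreasing_seqP => K.
rewrite {2}/radial_layers big_ord_recr /= lerDl.
by rewrite addr_ge0.
Qed.

Lemma radial_transform_nd x : {homo radial_transform ^~ x : m n / (m <= n)%N >-> m <= n}.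
Proof.
apply/nondecreasing_seqP => K.
rewrite {2}/radial_transform big_ord_recr /= lerDl.
by rewrite addr_ge0.
Qed.

Lemma prime_expz_lt_eventually (c : R) : 0 < c ->
  \forall n \near \oo, pR ^ (b - n%:Z) < c.
Proof.
move=> c0; have : (pR^-1) ^+ n @[n --> \oo] --> (0 : R).
  by apply: cvg_expr; rewrite ger0_norm ?invr_ge0 ?ltW // invf_lt1.
have cb : 0 < c / pR ^ b by rewrite divr_gt0.
move=> /cvgrPdist_lt /(_ _ cb); apply: filterS => n /=.
rewrite sub0r normrN ger0_norm ?exprn_ge0 ?invr_ge0 ?ltW // ltr_pdivlMr // mulrC.
by rewrite pXD exprVn -exprnN.
Qed.

Lemma radial_layers_cvg xi : radial_layers K xi @[K --> \oo] --> psi (abs xi).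
Proof.
have E : radial_layers ^~ xi = (fun K : nat => psi (Num.max (abs xi) (pR ^ (b - K%:Z))) -
    psi (Num.max (abs xi) (pR ^ (b + K%:Z)))) by apply/funext => K; exact: radial_layersE.
rewrite E -[X in _ --> X]subr0; apply: cvgB.
  have [xi0|xi0] := eqVneq (abs xi) 0.
    rewrite xi0 (_ : (fun K => _) = (fun n : nat => psi (pR ^ (b - n%:Z)))) //.
    by apply/funext => n; rewrite max_r // ltW.
  apply: cvg_near_cst; have a0 : 0 < abs xi by rewrite lt_neqAle eq_sym xi0 padic_abs_ge0.
  have := prime_expz_lt_eventually a0; apply: filterS => n h.
  by rewrite max_l // ltW.
apply: (squeeze_cvgr _ (@cvg_cst _ (0 : R) _ _ _) psi_cvgy); apply: nearW => n.
by rewrite psi_ge0 /= psi_noninc ?(ltW (pX_gt0 _)) // le_max lexx orbT.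
Qed.

Lemma measurable_ball_indic k :
  measurable_fun setT (fun xi : Qp_borel R p_pr => \1_(ball k) (xi : Qp) : R).
Proof. exact: measurable_indic (@measurable_padic_ball R p p_pr k). Qed.

Lemma measurable_radial_layers K :
  measurable_fun setT (radial_layers K : Qp_borel R p_pr -> R).
Proof.
apply: measurable_sum => i; apply: measurable_funD; apply: measurable_funM => //;
  exact: measurable_ball_indic.
Qed.

Lemma integrable_ball_indic k (f : Qp -> R) :
  measurable_fun setT (f : Qp_borel R p_pr -> R) -> (forall x, `|f x| <= 1) ->
  mu.-integrable setT (fun xi : Qp_borel R p_pr => (f xi * \1_(ball k) (xi : Qp))%:E).
Proof.
move=> mf f1; have := integrable_ball mu_haar k mf f1.
move/(integrable_mkcond _ (@measurable_padic_ball R p p_pr k)).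
by apply: eq_integrable => // xi _; rewrite patchE /= indicE;
  case: ifP => _; rewrite ?mulr1 ?mulr0.
Qed.

Lemma integral_ball_indic k (f : Qp -> R) :
  (\int[mu]_xi (f xi * \1_(ball k) (xi : Qp)) = \int[mu]_(xi in ball k) f xi)%R.
Proof.
rewrite [RHS]Rintegral_mkcond; apply: eq_Rintegral => xi _.
by rewrite patchE indicE; case: ifP => _; rewrite ?mulr1 ?mulr0.
Qed.

Let cosx x (xi : Qp) : R := cos (padic_angle R (xi * x)).

Lemma integral_cos_ball_indic k x :
  (\int[mu]_xi (cosx x xi * \1_(ball k) (xi : Qp)) = pR ^ k * \1_(ball (- k)) x)%R.
Proof.
rewrite integral_ball_indic indicE; have [xk|] := boolP (x \in ball (- k)).
  by rewrite inE in xk; rewrite integral_cos_ball_trivial // mulr1.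
rewrite notin_setE /padic_ball /= => /negP; rewrite -ltNge => kx.
by rewrite integral_cos_ball_nontrivial // mulr0.
Qed.

Lemma integral_radial_layers x K :
  mu.-integrable setT (fun xi : Qp_borel R p_pr => (cosx x xi * radial_layers K xi)%:E) /\
  (\int[mu]_xi (cosx x xi * radial_layers K xi) = radial_transform K x)%R.
Proof.
have ic1 k : mu.-integrable setT
    (fun xi : Qp_borel R p_pr => (cosx x xi * \1_(ball k) (xi : Qp))%:E).
  apply: integrable_ball_indic => [|xi]; [exact: measurable_cos_padic|exact: norm_cos_le1].
have ic k : mu.-integrable setT
    (fun xi : Qp_borel R p_pr => (w k * (cosx x xi * \1_(ball k) (xi : Qp)))%:E).
  exact: (integrableZl measurableT (w k) (ic1 k)).
have Ic k : (\int[mu]_xi (w k * (cosx x xi * \1_(ball k) (xi : Qp))) =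
    w k * pR ^ k * \1_(ball (- k)) x)%R.
  by rewrite (RintegralZl (w k) measurableT (ic1 k)) (integral_cos_ball_indic k x) mulrA.
elim: K => [|K [IHi IH]].
  rewrite /radial_layers /radial_transform big_ord0; split.
    by under eq_fun do rewrite big_ord0 mulr0; exact: integrable0.
  by under eq_Rintegral do rewrite big_ord0 mulr0; rewrite Rintegral_cst // mul0r.
have E xi : cosx x xi * radial_layers K.+1 xi = cosx x xi * radial_layers K xi +
    (w (b + K%:Z) * (cosx x xi * \1_(ball (b + K%:Z)) xi) +
     w (b - 1 - K%:Z) * (cosx x xi * \1_(ball (b - 1 - K%:Z)) xi)).
  by rewrite {1}/radial_layers big_ord_recr /= -/(radial_layers K xi); ring.
have i2 := integrableD measurableT (ic (b + K%:Z)) (ic (b - 1 - K%:Z)).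
split; first by under eq_fun do rewrite E; exact: (integrableD measurableT IHi i2).
under eq_Rintegral do rewrite E.
rewrite (RintegralD measurableT IHi i2).
rewrite (RintegralD measurableT (ic (b + K%:Z)) (ic (b - 1 - K%:Z))).
rewrite [RHS]/radial_transform big_ord_recr /=.
by congr (_ + (_ + _)); [exact: IH|exact: Ic|exact: Ic].
Qed.

Lemma measurable_radial : measurable_fun setT (fun xi : Qp_borel R p_pr => psi (abs (xi : Qp))).
Proof.
apply: (measurable_fun_cvg (h := fun K => radial_layers K : Qp_borel R p_pr -> R)).
  exact: measurable_radial_layers.
by move=> xi _; exact: radial_layers_cvg.
Qed.

Lemma integrable_radial :
  mu.-integrable setT (fun xi : Qp_borel R p_pr => (psi (abs (xi : Qp)))%:E).
Proof.
apply/integrableP; split; first by apply/measurable_EFinP; exact: measurable_radial.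
apply: (@le_lt_trans _ _ M%:E); last exact: ltry.
under eq_integral do rewrite gee0_abs ?lee_fin //.
have E : (fun xi : Qp_borel R p_pr => (psi (abs (xi : Qp)))%:E) =
    (fun xi : Qp_borel R p_pr => limn (fun K => (radial_layers K xi)%:E)).
  by apply/funext => xi; apply/esym/cvg_lim => //; apply: cvg_EFin;
    [exact: nearW|exact: radial_layers_cvg].
rewrite E monotone_convergence //.
- apply: lime_le; first apply: ereal_nondecreasing_is_cvgn => m n mn.
    apply: ge0_le_integral => // [xi _|||xi _].
    + by rewrite lee_fin radial_layers_ge0.
    + by apply/measurable_EFinP; exact: measurable_radial_layers.
    + by apply/measurable_EFinP; exact: measurable_radial_layers.
    + by rewrite lee_fin; exact: radial_layers_nd.
  apply: nearW => K.
  (* At frequency argument 0 the cosine is 1, so the integral of the layers is a value of the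
     transform and is bounded by [M]. *)
  have [i0 I0] := integral_radial_layers 0 K.
  have cos1 xi : cosx 0 xi = 1.
    apply: (padic_angle_int _).1; rewrite (mulr0 xi) padic_abs0; exact: ler01.
  have cosE : (fun xi : Qp_borel R p_pr => cosx 0 xi * radial_layers K xi) = radial_layers K.
    by apply/funext => xi; rewrite cos1 mul1r.
  rewrite cosE in I0; rewrite (_ : (fun xi => _) = EFin \o radial_layers K) in i0; last first.
    by apply/funext => xi; rewrite /= cos1 mul1r.
  rewrite -(fineK (integrable_fin_num measurableT i0)) lee_fin.
  by move: I0; rewrite /Rintegral => ->; exact: radial_transform_le.
- by move=> K; apply/measurable_EFinP; exact: measurable_radial_layers.
- by move=> K xi _; rewrite lee_fin radial_layers_ge0.
- by move=> xi _ m n mn; rewrite lee_fin; exact: radial_layers_nd.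
Qed.

(** Dominated convergence with majorant $\psi(|\xi|_p)$, each partial sum of layers lying between 0
    and the profile. *)
Lemma radial_transform_cvg x : radial_transform K x @[K --> \oo] -->
  (\int[mu]_xi (cosx x xi * psi (abs (xi : Qp))))%R.
Proof.
have mc := @measurable_cos_padic R p p_pr x.
pose f K (xi : Qp_borel R p_pr) := (cosx x xi * radial_layers K xi)%:E.
have mf K : measurable_fun setT (f K) by exact: measurable_int (integral_radial_layers x K).1.
have cf (xi : Qp_borel R p_pr) : setT xi -> f ^~ xi @ \oo --> (cosx x xi * psi (abs (xi : Qp)))%:E.
  move=> _; apply: cvg_EFin; first exact: nearW.
  by apply: cvgM; [exact: cvg_cst|exact: radial_layers_cvg].
have bf K (xi : Qp_borel R p_pr) : setT xi -> (`|f K xi| <= (psi (abs (xi : Qp)))%:E)%E.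
  move=> _; rewrite lee_fin normrM -[leRHS]mul1r ler_pM ?norm_cos_le1 //.
  by rewrite ger0_norm ?radial_layers_ge0 // radial_layers_le.
have mlim : measurable_fun setT (fun xi : Qp_borel R p_pr => (cosx x xi * psi (abs (xi : Qp)))%:E).
  by apply/measurable_EFinP; apply: measurable_funM => //; exact: measurable_radial.
have ae_cf : \forall xi \ae mu, setT xi -> f ^~ xi @ \oo --> (cosx x xi * psi (abs xi))%:E.
  by apply: aeW.
have ae_bf : \forall xi \ae mu, forall K, setT xi -> (`|f K xi| <= (psi (abs xi))%:E)%E.
  by apply: aeW => xi K h; exact: bf.
have [ilim _] := dominated_convergence measurableT mf mlim ae_cf integrable_radial ae_bf.
rewrite -(fineK (integrable_fin_num measurableT ilim)).
have -> : (fun K => \int[mu]_xi f K xi)%E = (fun K => (radial_transform K x)%:E).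
  apply/funext => K; have [i <-] := integral_radial_layers x K.
  by rewrite /Rintegral fineK // (integrable_fin_num measurableT i).
by move/fine_cvgP => [_].
Qed.

End radial_fourier.

(** * The series of $c(t)$ as a geometric sum of exponentials *)

Section geometric_exponential_series.
Context (R : realType).
Variables (a q : R).
Hypothesis a_gt1 : 1 < a.
Hypothesis q_ge0 : 0 <= q.
Hypothesis q_le1 : q <= 1.
Implicit Types (y : R).

Let a_gt0 : 0 < a. Proof. exact: lt_trans a_gt1. Qed.

(* [gexp y = sum_n (- y)^n / (n! (1 - q^n / a))] is the series in [cN]; expanding
   the denominator turns it into [sum_i a^-i exp (- y q^i)]. *)
Definition gexp_coeff y n : R := exp_coeff (- y) n / (1 - q ^+ n / a).

Let den_gt0 : 0 < 1 - a^-1. Proof. by rewrite subr_gt0 invf_lt1. Qed.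

Let den_le n : 1 - a^-1 <= 1 - q ^+ n / a.
Proof.
rewrite lerD2l lerN2; apply: ler_piMl; first by rewrite invr_ge0 ltW.
exact: exprn_ile1.
Qed.

Let denn_gt0 n : 0 < 1 - q ^+ n / a. Proof. exact: lt_le_trans (den_le n). Qed.

(** All denominators are at least $1 - 1/a$. Comparison with the exponential series yields
    convergence and a bound increasing in [y], which later controls the remainders. *)
Lemma gexp_coeff_norm_le y n : 0 <= y -> `|gexp_coeff y n| <= (1 - a^-1)^-1 * exp_coeff y n.
Proof.
move=> y0; rewrite /gexp_coeff normrM normfV (gtr0_norm (denn_gt0 n)) mulrC.
have -> : `|exp_coeff (- y) n| = exp_coeff y n.
  by rewrite /exp_coeff normrM normrX normrN (ger0_norm y0) ger0_norm ?invr_ge0 ?ler0n.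
apply: ler_wpM2r; first by rewrite /exp_coeff divr_ge0 ?exprn_ge0 ?ler0n.
by rewrite lef_pV2 ?posrE ?den_gt0 ?denn_gt0 // den_le.
Qed.

Let cvg_major y : cvgn (series (fun n => (1 - a^-1)^-1 * exp_coeff y n)).
Proof.
rewrite (_ : (fun n => _) = (1 - a^-1)^-1 *: exp_coeff y) //.
by apply: is_cvg_seriesZ; exact: is_cvg_series_exp_coeff.
Qed.

Lemma gexp_normed_cvg y : 0 <= y -> cvgn [normed series (gexp_coeff y)].
Proof.
move=> y0; apply: (@series_le_cvg R (fun n => `|gexp_coeff y n|)
  (fun n => (1 - a^-1)^-1 * exp_coeff y n)) => [n|n|n|].
- exact: normr_ge0.
- by rewrite mulr_ge0 ?invr_ge0 ?(ltW den_gt0) // /exp_coeff divr_ge0 ?exprn_ge0 ?ler0n.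
- exact: gexp_coeff_norm_le.
- exact: cvg_major.
Qed.

Lemma gexp_cvg y : 0 <= y -> cvgn (series (gexp_coeff y)).
Proof. by move=> y0; apply: normed_cvg; exact: gexp_normed_cvg. Qed.

Definition gexp y : R := limn (series (gexp_coeff y)).

Lemma gexp_norm_le y : 0 <= y -> `|gexp y| <= (1 - a^-1)^-1 * expR y.
Proof.
move=> y0; apply: le_trans (lim_series_norm (gexp_normed_cvg y0)) _.
have -> : (1 - a^-1)^-1 * expR y = limn (series ((1 - a^-1)^-1 *: exp_coeff y)).
  by rewrite lim_seriesZ //; exact: is_cvg_series_exp_coeff.
apply: lim_series_le; [exact: gexp_normed_cvg|exact: cvg_major|].
by move=> n; exact: gexp_coeff_norm_le.
Qed.

(** Termwise, $1/D = 1 + (q^n/a)/D$ for $D = 1 - q^n/a$, and the factor $q^n$ turns $y$ into $qy$.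
    Iterating this identity replaces the exchange of a double series. *)
Lemma gexp_functional y : 0 <= y -> gexp y = expR (- y) + a^-1 * gexp (q * y).
Proof.
move=> y0; have qy0 : 0 <= q * y by rewrite mulr_ge0.
rewrite /gexp; have -> : gexp_coeff y = exp_coeff (- y) + a^-1 *: gexp_coeff (q * y).
  apply/funext => n; rewrite /gexp_coeff fctE /= /GRing.scale /=.
  have -> : exp_coeff (- (q * y)) n = q ^+ n * exp_coeff (- y) n.
    by rewrite /exp_coeff /= -mulrN exprMn mulrA.
  rewrite -[a^-1 *: _]/(a^-1 * _); set D := 1 - _; set e := exp_coeff _ _.
  have D0 : D != 0 by rewrite gt_eqF // denn_gt0.
  have -> : a^-1 * (q ^+ n * e / D) = (1 - D) * e / D by rewrite {2}/D subKr; ring.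
  by field.
rewrite lim_seriesD; last 2 first.
- exact: is_cvg_series_exp_coeff.
- by apply: is_cvg_seriesZ; exact: gexp_cvg.
by rewrite lim_seriesZ //; exact: gexp_cvg.
Qed.

Definition gexp_partial y (m : nat) : R := \sum_(i < m) a ^- i * expR (- (y * q ^+ i)).

Lemma gexp_partialE y m : 0 <= y ->
  gexp y = gexp_partial y m + a ^- m * gexp (y * q ^+ m).
Proof.
move=> y0; elim: m => [|m IH].
  by rewrite /gexp_partial big_ord0 expr0 invr1 mul1r mulr1 add0r.
rewrite /gexp_partial big_ord_recr /= -/(gexp_partial y m) {1}IH.
rewrite {1}gexp_functional ?mulr_ge0 ?exprn_ge0 //.
have -> : q * (y * q ^+ m) = y * q ^+ m.+1 by rewrite exprS; ring.
have -> : a ^- m.+1 = a ^- m * a^-1 by rewrite exprS invfM mulrC.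
by rewrite mulrDr !mulrA addrA.
Qed.

(** After [m] steps the remainder is $a^{-m}$ times the value at $yq^m \le y$, which the exponential
    bound at [y] controls uniformly in [m]. *)
Lemma gexp_partial_cvg y : 0 <= y -> gexp_partial y m @[m --> \oo] --> gexp y.
Proof.
move=> y0; pose C := (1 - a^-1)^-1 * expR y.
have C0 : 0 <= C by rewrite mulr_ge0 ?invr_ge0 ?(ltW den_gt0) ?expR_ge0.
have h0 : C * a^-1 ^+ m @[m --> \oo] --> (0 : R).
  rewrite -[X in _ --> X](mulr0 C); apply: cvgMr; apply: cvg_expr.
  by rewrite ger0_norm ?invr_ge0 ?ltW // invf_lt1.
apply/cvgrPdist_le => e e0; move/cvgrPdist_le : h0 => /(_ _ e0); apply: filterS => m.
rewrite sub0r normrN ger0_norm ?mulr_ge0 ?exprn_ge0 ?invr_ge0 ?(ltW a_gt0) ?(ltW den_gt0) //.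
apply: le_trans.
rewrite {1}(gexp_partialE m y0) addrAC subrr add0r normrM mulrC.
have am0 : 0 <= a ^- m by rewrite invr_ge0 exprn_ge0 // ltW.
rewrite [X in _ * X]ger0_norm // exprVn; apply: ler_wpM2r => //.
apply: le_trans (gexp_norm_le _) _; first by rewrite mulr_ge0 ?exprn_ge0.
apply: ler_wpM2l; first by rewrite invr_ge0 ltW.
rewrite ler_expR -[leRHS]mulr1.
by rewrite ler_wpM2l // exprn_ile1.
Qed.

End geometric_exponential_series.

Lemma prime_exprz_lower (R : realType) (p : nat) (p_pr : prime p) (b : int) (i : nat) :
  (p%:R : R) ^ (b - 1 - i%:Z) = p%:R ^ b * p%:R ^- i.+1.
Proof.
have -> : b - 1 - i%:Z = b + - i.+1%:Z by lia.
by rewrite expfzDr ?exprnN // pnatr_eq0 -lt0n prime_gt0.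
Qed.

(** * The profile $\exp(-t r^\alpha)$ at powers of $p$ *)

Section heat_profile.
Context (R : realType) (p : nat) (p_pr : prime p).
Local Notation pR := (p%:R : R).
Variables (alpha t : R) (b : int).
Hypotheses (alpha_gt0 : 0 < alpha) (t_gt0 : 0 < t).
Implicit Types (k : int).

Let p_gt0 : 0 < pR := prime_gt0r R p_pr.
Let p_gt1 : 1 < pR := prime_gt1r R p_pr.
Let pX_gt0 k : 0 < pR ^ k. Proof. exact: exprz_gt0. Qed.
Let pXD k l : pR ^ (k + l) = pR ^ k * pR ^ l.
Proof. by rewrite expfzDr // gt_eqF. Qed.

Definition heat_profile (r : R) : R := expR (- t * r `^ alpha).
Local Notation psi := heat_profile.
Local Notation w := (radial_weight p psi).

Lemma heat_profileE (r : R) : psi r = expR (- t * r `^ alpha). Proof. by []. Qed.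

Definition heat_ratio : R := pR `^ (- alpha).
Local Notation q := heat_ratio.

(** With these parameters the profile at $p^{b-n}$ is $\exp(-s q^n)$, exactly the exponentials
    summed by [gexp] with $a = p$. *)
Definition heat_scale : R := t * (pR ^ b) `^ alpha.
Local Notation s := heat_scale.

Lemma heat_ratio_gt0 : 0 < q. Proof. exact: powR_gt0. Qed.

Lemma heat_ratio_lt1 : q < 1.
Proof.
by rewrite /heat_ratio /powR gt_eqF // expR_lt1 mulNr oppr_lt0 mulr_gt0 // ln_gt0.
Qed.

Lemma heat_scale_gt0 : 0 < s.
Proof. by rewrite mulr_gt0 // powR_gt0. Qed.

Lemma powR_exprz k : (pR ^ k) `^ alpha = pR `^ (k%:~R * alpha).
Proof. by rewrite -powR_intmul ?(ltW p_gt0) // -powRrM. Qed.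

Lemma heat_ratioX (n : nat) : q ^+ n = pR `^ (- n%:R * alpha).
Proof. by rewrite -powR_mulrn ?powR_ge0 // -powRrM mulrC mulNr mulrN. Qed.

Lemma heat_profile_down (n : nat) : psi (pR ^ (b - n%:Z)) = expR (- (s * q ^+ n)).
Proof.
rewrite /heat_profile /heat_scale !powR_exprz heat_ratioX mulNr -mulrA -powRD; last first.
  by rewrite (gt_eqF p_gt0) implybT.
by rewrite intrB -pmulrn mulrBl mulNr.
Qed.

Lemma heat_profile_up (n : nat) : psi (pR ^ (b + n%:Z)) = expR (- (s / q ^+ n)).
Proof.
rewrite /heat_profile /heat_scale !powR_exprz heat_ratioX mulNr -mulrA mulNr powRN invrK -powRD; last first.
  by rewrite (gt_eqF p_gt0) implybT.
by rewrite intrD -pmulrn mulrDl.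
Qed.

Lemma heat_profile_ge0 r : 0 <= psi r. Proof. exact: expR_ge0. Qed.

Lemma heat_profile_noninc (r1 r2 : R) : 0 <= r1 -> r1 <= r2 -> psi r2 <= psi r1.
Proof.
move=> r0 r12; rewrite ler_expR !mulNr lerN2 ler_wpM2l ?(ltW t_gt0) //.
by apply: ge0_ler_powR; rewrite ?nnegrE ?(ltW alpha_gt0) //; exact: le_trans r12.
Qed.

Lemma heat_profile0 : psi 0 = 1.
Proof. by rewrite /heat_profile powR0 ?gt_eqF // mulr0 expR0. Qed.

Lemma heat_profile_le1 r : 0 <= r -> psi r <= 1.
Proof. by move=> r0; rewrite -heat_profile0; exact: heat_profile_noninc. Qed.

#[local] Opaque heat_profile.

Let ratio_cvg : q ^+ n @[n --> \oo] --> (0 : R).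
Proof.
by apply: cvg_expr; rewrite ger0_norm ?(ltW heat_ratio_gt0) // heat_ratio_lt1.
Qed.

Lemma heat_profile_cvg0 : psi (pR ^ (b - n%:Z)) @[n --> \oo] --> psi 0.
Proof.
have -> : psi 0 = expR (- (s * 0)) by rewrite heat_profile0 mulr0 oppr0 expR0.
under eq_fun do rewrite heat_profile_down.
apply: continuous_cvg; first exact: continuous_expR.
by apply: cvgN; apply: cvgMr; exact: ratio_cvg.
Qed.

Lemma heat_profile_cvgy : psi (pR ^ (b + n%:Z)) @[n --> \oo] --> (0 : R).
Proof.
have h : q ^+ n / s @[n --> \oo] --> (0 : R).
  by rewrite -(mul0r s^-1); apply: cvgMl; exact: ratio_cvg.
apply: (squeeze_cvgr _ (@cvg_cst _ (0 : R) _ _ _) h); apply: nearW => n.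
rewrite heat_profile_ge0 /= heat_profile_up expRN.
have y0 : 0 < s / q ^+ n by rewrite divr_gt0 ?heat_scale_gt0 // exprn_gt0 // heat_ratio_gt0.
rewrite -[leRHS]invf_div lef_pV2 ?posrE ?expR_gt0 //.
by apply: le_trans (expR_ge1Dx _); rewrite lerDr.
Qed.

Lemma heat_weight_ge0 k : 0 <= w k.
Proof. exact: (radial_weight_ge0 p_pr heat_profile_noninc). Qed.

Let geometric_le (r : R) (K : nat) : 0 <= r -> r < 1 -> \sum_(i < K) r ^+ i <= (1 - r)^-1.
Proof.
move=> r0 r1; have d0 : 0 < 1 - r by rewrite subr_gt0.
rewrite -[leRHS]mul1r ler_pdivlMr //.
have -> : (\sum_(i < K) r ^+ i) * (1 - r) = 1 - r ^+ K.
  elim: K => [|K IH]; first by rewrite big_ord0 mul0r expr0 subrr.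
  by rewrite big_ord_recr /= mulrDl IH exprSr; ring.
by rewrite gerBl exprn_ge0.
Qed.

Let telescope_down (u : int -> R) (K : nat) :
  \sum_(i < K) (u (b - 1 - i%:Z) - u (b - 1 - i%:Z + 1)) = u (b - K%:Z) - u b.
Proof.
elim: K => [|K IH]; first by rewrite big_ord0 subr0 subrr.
rewrite big_ord_recr /= IH.
have -> : b - 1 - K%:Z + 1 = b - K%:Z by lia.
have -> : b - 1 - K%:Z = b - K.+1%:Z by lia.
by rewrite addrC addrA subrK.
Qed.

Let telescope_up (u : int -> R) (K : nat) :
  \sum_(i < K) (u (b + i%:Z) - u (b + i%:Z + 1)) = u b - u (b + K%:Z).
Proof.
elim: K => [|K IH]; first by rewrite big_ord0 addr0 subrr.
rewrite big_ord_recr /= IH.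
have -> : b + K%:Z + 1 = b + K.+1%:Z by lia.
by rewrite addrA subrK.
Qed.

Lemma heat_lower_sum (K : nat) :
  \sum_(i < K) w (b - 1 - i%:Z) = psi (pR ^ (b - K%:Z)) - psi (pR ^ b).
Proof. exact: (telescope_down (fun k => psi (pR ^ k))). Qed.

Lemma heat_upper_sum (K : nat) :
  \sum_(i < K) w (b + i%:Z) = psi (pR ^ b) - psi (pR ^ (b + K%:Z)).
Proof. exact: (telescope_up (fun k => psi (pR ^ k))). Qed.

(** Upwards, the decay of $\exp(-s/q^i)$ beats the growth of $p^i$; downwards, the powers are at
    most $p^b$ and the weights telescope to at most 1. *)
Lemma heat_weight_summable : exists M : R, forall K : nat,
  \sum_(i < K) (w (b + i%:Z) * pR ^ (b + i%:Z) +
                w (b - 1 - i%:Z) * pR ^ (b - 1 - i%:Z)) <= M.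
Proof.
pose r := pR^-1; have r0 : 0 < r by rewrite invr_gt0.
have r1 : r < 1 by rewrite invf_lt1.
(* Large enough that $m\alpha \ge 2$, so $q^m \le p^{-2}$. The inequality $e^y \ge (y/m)^m$ then
   bounds the weights by a multiple of $p^{-2i}$, and a geometric series of ratio $1/p$ remains. *)
pose m := (Num.truncn (2 / alpha)).+1.
have m0 : 0 < m%:R :> R by rewrite ltr0n.
have qm : q ^+ m <= r ^+ 2.
  rewrite /r heat_ratioX -powR_inv1 ?(ltW p_gt0) // -powR_mulrn ?powR_ge0 // -powRrM.
  apply: ler_powR; first exact: ltW.
  have : 2 / alpha < m%:R by exact: truncnS_gt.
  by rewrite ltr_pdivrMr //; lra.
pose C := pR ^ b * (m%:R / s) ^+ m.
have C0 : 0 <= C.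
  by rewrite mulr_ge0 ?(ltW (pX_gt0 _)) // exprn_ge0 // divr_ge0 ?ler0n // (ltW heat_scale_gt0).
exists (C * (1 - r)^-1 + pR ^ b) => K; rewrite big_split /=; apply: lerD.
  apply: le_trans (_ : C * \sum_(i < K) r ^+ i <= _); last first.
    by apply: ler_wpM2l => //; apply: geometric_le => //; exact: ltW.
  rewrite mulr_sumr; apply: ler_sum => i _.
  have y0 : 0 < s / q ^+ i by rewrite divr_gt0 ?heat_scale_gt0 // exprn_gt0 // heat_ratio_gt0.
  have h1 : w (b + i%:Z) <= (m%:R / s) ^+ m * (r ^+ 2) ^+ i.
    apply: (@le_trans _ _ (psi (pR ^ (b + i%:Z)))); first by rewrite gerBl heat_profile_ge0.
    rewrite heat_profile_up expRN.
    apply: (@le_trans _ _ ((m%:R / s) ^+ m * (q ^+ m) ^+ i)); last first.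
      apply: ler_wpM2l; first by rewrite exprn_ge0 // divr_ge0 ?ler0n // (ltW heat_scale_gt0).
      by apply: lerXn2r; rewrite ?nnegrE ?exprn_ge0 // ?(ltW r0) // (ltW heat_ratio_gt0).
    have -> : (m%:R / s) ^+ m * (q ^+ m) ^+ i = (((s / q ^+ i) / m%:R) ^+ m)^-1.
      by rewrite exprAC -exprMn -exprVn invf_div invf_div -mulrA mulrC -!mulrA; congr (_ ^+ _); ring.
    have z0 : 0 < (s / q ^+ i / m%:R) ^+ m by rewrite exprn_gt0 // (divr_gt0 y0 m0).
    rewrite lef_pV2 ?posrE ?expR_gt0 //.
    have -> : s / q ^+ i = m%:R * ((s / q ^+ i) / m%:R) by rewrite [RHS]mulrC divfK // gt_eqF.
    rewrite expRM_natl [X in X / _]mulrC mulfK ?gt_eqF //.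
    apply: lerXn2r; [by rewrite nnegrE (ltW (divr_gt0 y0 m0))|by rewrite nnegrE expR_ge0|].
    by apply: le_trans (expR_ge1Dx _); rewrite lerDr.
  apply: le_trans (ler_wpM2r (ltW (pX_gt0 _)) h1) _.
  rewrite pXD -[pR ^ i%:Z]/(pR ^+ i) /C.
  have -> : r ^+ i = (r ^+ 2) ^+ i * pR ^+ i.
    by rewrite -exprMn expr2 -mulrA mulVf ?mulr1 // gt_eqF.
  by rewrite le_eqVlt; apply/orP; left; apply/eqP; ring.
apply: (@le_trans _ _ (\sum_(i < K) w (b - 1 - i%:Z) * pR ^ b)).
  apply: ler_sum => i _; apply: ler_wpM2l; first exact: heat_weight_ge0.
  by rewrite ler_eXz2l //; lia.
rewrite -mulr_suml heat_lower_sum -[leRHS]mul1r; apply: ler_wpM2r; first exact: ltW.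
apply: le_trans (_ : psi (pR ^ (b - K%:Z)) <= 1); first by rewrite gerBl heat_profile_ge0.
by apply: heat_profile_le1; exact: ltW.
Qed.

(* Abel summation. *)
Lemma heat_lower_weighted_sum (K : nat) :
  psi (pR ^ b) + \sum_(i < K) w (b - 1 - i%:Z) * pR ^- i.+1 =
  (1 - pR^-1) * gexp_partial pR q s K + psi (pR ^ (b - K%:Z)) * pR ^- K.
Proof.
elim: K => [|K IH].
  by rewrite big_ord0 /gexp_partial big_ord0 mulr0 addr0 add0r subr0 expr0 invr1 mulr1.
rewrite big_ord_recr /= addrA IH /gexp_partial big_ord_recr /= -/(gexp_partial pR q s K).
rewrite -heat_profile_down /radial_weight.
have -> : b - 1 - K%:Z + 1 = b - K%:Z by lia.
have -> : b - 1 - K%:Z = b - K.+1%:Z by lia.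
have -> : pR ^- K.+1 = pR ^- K * pR^-1 by rewrite exprS invfM mulrC.
move: (psi (pR ^ (b - K%:Z))) (psi (pR ^ (b - K.+1%:Z))) (gexp_partial pR q s K).
by move: (pR ^- K) (pR^-1) => u v x y g; ring.
Qed.

End heat_profile.

#[local] Opaque heat_profile.

(** * Positivity and mass of the kernel on the ball *)

Section ball_kernel.
Context (R : realType) (p : nat) (p_pr : prime p).
Local Notation Qp := (Qp p_pr).
Local Notation abs := (padic_abs R).
Local Notation pR := (p%:R : R).
Local Notation ball := (@padic_ball R p p_pr).
Context (mu : {measure set (Qp_borel R p_pr) -> \bar R}).
Hypothesis mu_haar : normalized_haar mu.
Variables (N : int) (alpha t : R).
Hypotheses (alpha_gt0 : 0 < alpha) (t_gt0 : 0 < t).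
Implicit Types (x y : Qp) (k : int).

Let p_gt0 : 0 < pR := prime_gt0r R p_pr.
Let p_gt1 : 1 < pR := prime_gt1r R p_pr.
Let pX_gt0 k : 0 < pR ^ k. Proof. exact: exprz_gt0. Qed.

Local Notation b := (- N).
Local Notation psi := (heat_profile alpha t).
Local Notation w := (radial_weight p psi).
Local Notation q := (heat_ratio p alpha : R).
Local Notation s := (heat_scale p alpha t b).
Local Notation S := (gexp pR q s).
Local Notation Z := (heat_kernel mu alpha t).
Local Notation a := (radial_transform psi b).
Local Notation nu := (haar_ball mu N).

Let psi_noninc := heat_profile_noninc alpha_gt0 t_gt0.
Let q_ge0 : 0 <= q := ltW (heat_ratio_gt0 p_pr alpha).
Let q_le1 : q <= 1 := ltW (heat_ratio_lt1 p_pr alpha_gt0).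
Let s_ge0 : 0 <= s := ltW (heat_scale_gt0 p_pr alpha b t_gt0).

Lemma heat_kernelE x :
  Z x = (\int[mu]_xi (cos (padic_angle R ((xi : Qp) * x)) * psi (abs (xi : Qp))))%R.
Proof.
rewrite /heat_kernel /heat_kernelC /integralC /=; apply: eq_Rintegral => xi _.
by rewrite /padic_char /= mulr0 subr0.
Qed.

Lemma heat_kernel_cvg x : a K x @[K --> \oo] --> Z x.
Proof.
have [M HM] := heat_weight_summable p_pr b alpha_gt0 t_gt0.
rewrite heat_kernelE; apply: (radial_transform_cvg mu_haar _ psi_noninc _ _ HM).
- exact: heat_profile_ge0.
- exact: heat_profile_cvg0.
- exact: heat_profile_cvgy.
Qed.

Lemma heat_kernel_bounded : exists M : R, forall x, 0 <= Z x <= M.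
Proof.
have [M HM] := heat_weight_summable p_pr b alpha_gt0 t_gt0.
exists M => x; rewrite -(cvg_lim _ (@heat_kernel_cvg x)) //.
have c := cvgP _ (@heat_kernel_cvg x).
apply/andP; split; [apply: limr_ge c _|apply: limr_le c _]; apply: nearW => K.
  exact: radial_transform_ge0.
exact: (radial_transform_le psi_noninc HM).
Qed.

(** The series of $c(t)$ is [gexp] with $a = p$, $q = p^{-\alpha}$ and $y = t p^{-N\alpha}$. *)
Lemma cNE : cN p N alpha t =
  pR ^ b - pR ^ b * (1 - pR^-1) * expR (lambdaN p N alpha * t) * S.
Proof.
rewrite /cN /gexp; congr (_ - _ * _).
apply: (congr1 (fun u : R^nat => limn (series u))); apply/funext => n.
rewrite /gexp_coeff /exp_coeff /= -[in RHS]mulN1r exprMn /heat_scale exprMn.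
have -> : ((pR ^ b) `^ alpha) ^+ n = pR `^ (- N%:~R * alpha * n%:R).
  by rewrite powR_exprz // -powR_mulrn ?powR_ge0 // -powRrM mulrNz.
have -> : pR `^ (- alpha * n%:R - 1) = q ^+ n / pR.
  rewrite powRD; last by rewrite (gt_eqF p_gt0) implybT.
  by rewrite powR_inv1 ?(ltW p_gt0) // heat_ratioX //; congr (pR `^ _ / _); ring.
ring.
Qed.

Let gexp_step (K : nat) : pR ^ b * (psi (pR ^ b)) +
    \sum_(i < K) w (b - 1 - i%:Z) * pR ^ (b - 1 - i%:Z) =
  pR ^ b * ((1 - pR^-1) * gexp_partial pR q s K + psi (pR ^ (b - K%:Z)) * pR ^- K).
Proof.
rewrite -heat_lower_weighted_sum // mulrDr mulr_sumr; congr (_ + _).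
by apply: eq_bigr => i _; rewrite prime_exprz_lower // mulrCA mulrA.
Qed.

Let lower_bound_arith (U L r g c d e : R) : (d - c) * e <= U ->
  e * d + L = e * (g + r) -> 0 <= e * r -> e * (g - c) <= U + L.
Proof. by lra. Qed.

Lemma heat_kernel_ge x : ball N x ->
  pR ^ b * ((1 - pR^-1) * S - psi (pR ^ (b + 1))) <= Z x.
Proof.
move=> xN.
(* With [K + 1] terms the layer $k = -N$, of index 0, belongs to every upper sum. *)
have H : pR ^ b * ((1 - pR^-1) * gexp_partial pR q s K.+1 - psi (pR ^ (b + 1))) @[K --> \oo] -->
    pR ^ b * ((1 - pR^-1) * S - psi (pR ^ (b + 1))).
  apply: cvgMr; apply: cvgB; last exact: cvg_cst.
  apply: cvgMr; rewrite (cvg_shiftS (gexp_partial pR q s)).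
  exact: gexp_partial_cvg.
have H2 : a K.+1 x @[K --> \oo] --> Z x by rewrite (cvg_shiftS (a ^~ x)); exact: heat_kernel_cvg.
rewrite -(cvg_lim _ H) // -(cvg_lim _ H2) //.
apply: ler_lim; [exact: cvgP H|exact: cvgP H2|apply: nearW => K].
rewrite /radial_transform big_split /=.
have -> : \sum_(i < K.+1) w (b - 1 - i%:Z) * pR ^ (b - 1 - i%:Z) * \1_(ball (- (b - 1 - i%:Z))) x =
    \sum_(i < K.+1) w (b - 1 - i%:Z) * pR ^ (b - 1 - i%:Z).
  apply: eq_bigr => i _; rewrite indicE mem_set ?mulr1 //.
  by apply: le_trans xN _; rewrite ler_eXz2l //; lia.
(* Among the upper layers, only $k = -N$ is sure to have [x] in its transformed ball; the others are
   nonnegative and dropped. *)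
have up : w b * pR ^ b <=
    \sum_(i < K.+1) w (b + i%:Z) * pR ^ (b + i%:Z) * \1_(ball (- (b + i%:Z))) x.
  rewrite big_ord_recl /= addr0 opprK indicE mem_set ?mulr1 // lerDl.
  apply: sumr_ge0 => i _; rewrite mulr_ge0 ?indicE ?ler0n // mulr_ge0 ?(ltW (pX_gt0 _)) //.
  exact: heat_weight_ge0.
have wb : w b = psi (pR ^ b) - psi (pR ^ (b + 1)) by [].
have low := gexp_step K.+1; rewrite wb in up.
have rem : 0 <= pR ^ b * (psi (pR ^ (b - K.+1%:Z)) * pR ^- K.+1).
  apply: mulr_ge0; first exact: ltW.
  apply: mulr_ge0; first exact: heat_profile_ge0.
  by rewrite invr_ge0 exprn_ge0 // ltW.
exact: (lower_bound_arith up low rem).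
Qed.

(** The fraction in $\lambda$ is at most 1, because $p \le p^{\alpha+1}$. *)
Lemma lambdaN_ge : lambdaN p N alpha * t <= t * (pR ^ (b + 1)) `^ alpha.
Proof.
rewrite mulrC; apply: ler_wpM2l; first exact: ltW.
rewrite /lambdaN powR_exprz //.
have -> : alpha * (1 - N%:~R) = (- N + 1)%:~R * alpha by rewrite intrD mulrNz addrC mulrC.
rewrite -[leRHS]mul1r; apply: ler_wpM2r; first exact: powR_ge0.
have h : pR <= pR `^ (alpha + 1).
  by rewrite -{1}(powRr1 (ltW p_gt0)); apply: ler_powR; [exact: ltW|rewrite lerDr ltW].
by rewrite ler_pdivrMr ?mul1r ?lerD2r // subr_gt0; exact: lt_le_trans h.
Qed.

Lemma ball_heat_kernel_ge0 x : ball N x -> 0 <= ball_heat_kernel mu N alpha t x.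
Proof.
move=> /heat_kernel_ge h; rewrite /ball_heat_kernel cNE.
set e := expR _; have e0 : 0 <= e by exact: expR_ge0.
have := ler_wpM2l e0 h.
have : e * psi (pR ^ (b + 1)) <= 1.
  rewrite /e heat_profileE -expRD -[leRHS]expR0 ler_expR.
  have := lambdaN_ge; lra.
move=> /(ler_wpM2l (ltW (pX_gt0 b))); lra.
Qed.

Lemma heat_kernelN x : Z (- x) = Z x.
Proof.
have c := @heat_kernel_cvg (- x).
have iN k : \1_(ball k) (- x) = \1_(ball k) x :> R.
  by rewrite !indicE; congr (_%:R); congr nat_of_bool; apply/idP/idP;
    rewrite !inE /padic_ball /= padic_absN.
have E : a ^~ (- x) = a ^~ x.
  by apply/funext => K; rewrite /radial_transform; apply: eq_bigr => i _; rewrite !iN.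
rewrite E in c; exact: (cvg_unique _ c (@heat_kernel_cvg x)).
Qed.

Lemma measurable_heat_kernel_diff :
  measurable_fun setT (fun z : Qp_borel R p_pr * Qp_borel R p_pr => Z ((z.1 : Qp) - z.2)).
Proof.
apply: (measurable_fun_cvg (h := fun K (z : Qp_borel R p_pr * Qp_borel R p_pr) => a K ((z.1 : Qp) - z.2))).
  move=> K; apply: measurable_sum => i; apply: measurable_funD; apply: measurable_funM => //.
    exact: (measurable_indic (measurable_padic_diag (pX_gt0 (- (b + i%:Z))))).
  exact: (measurable_indic (measurable_padic_diag (pX_gt0 (- (b - 1 - i%:Z))))).
by move=> z _; exact: heat_kernel_cvg.
Qed.

Lemma haar_ball_disc_le x k :
  (nu (padic_disc x (pR ^ k)) <= (pR ^ k)%:E)%E.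
Proof.
rewrite -(haar_discE mu_haar x k) /haar_ball /mrestr.
apply: le_measure; rewrite ?inE //.
- by apply: measurableI; [exact: measurable_padic_disc|exact: measurable_padic_ball].
- exact: measurable_padic_disc.
Qed.

Lemma haar_ball_setT : nu setT = (pR ^ N)%:E.
Proof. by rewrite /haar_ball /mrestr setTI haar_ballE. Qed.

(** Bounds the integral over $B_N$ of the truncated transform. A layer $k \ge -N$ contributes at
    most $w_k p^k p^{-k} = w_k$, and these telescope to at most $\psi(p^{-N})$; a layer below
    contributes at most $w_k p^k p^N$. *)
Let mass_partial (K : nat) : R :=
  psi (pR ^ b) + \sum_(i < K) w (b - 1 - i%:Z) * pR ^- i.+1.

Let mass_partial_le K : mass_partial K <= (1 - pR^-1) * S.
Proof.
have c : mass_partial K @[K --> \oo] --> (1 - pR^-1) * S.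
  have h : psi (pR ^ (b - n%:Z)) * pR^-1 ^+ n @[n --> \oo] --> (0 : R).
    rewrite -[X in _ --> X](mulr0 (psi 0)); apply: cvgM; first exact: heat_profile_cvg0.
    by apply: cvg_expr; rewrite ger0_norm ?invr_ge0 ?(ltW p_gt0) // invf_lt1.
  rewrite -[X in _ --> X]addr0.
  have -> : mass_partial = (fun K => (1 - pR^-1) * gexp_partial pR q s K + psi (pR ^ (b - K%:Z)) * pR^-1 ^+ K).
    by apply/funext => n; rewrite /mass_partial heat_lower_weighted_sum // exprVn.
  by apply: cvgD => //; apply: cvgMr; exact: gexp_partial_cvg.
rewrite -(cvg_lim _ c) //; apply: (@nondecreasing_cvgn_le _ mass_partial); last exact: cvgP c.
apply/nondecreasing_seqP => n; rewrite {2}/mass_partial big_ord_recr /= addrA lerDl.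
by rewrite mulr_ge0 ?heat_weight_ge0 // invr_ge0 exprn_ge0 // ltW.
Qed.

Let indic_diff k x y : \1_(ball k) (x - y) = \1_(padic_disc x (pR ^ k)) (y : Qp_borel R p_pr) :> R.
Proof.
rewrite !indicE; congr (_%:R); congr nat_of_bool.
by apply/idP/idP => /set_mem h; apply/mem_set; move: h;
  rewrite /padic_ball /padic_disc /= padic_abs_distC.
Qed.

Let integral_indic_disc (c : R) k x : 0 <= c ->
  (\int[nu]_y (c * \1_(padic_disc x (pR ^ k)) (y : Qp_borel R p_pr))%:E =
   c%:E * nu (padic_disc x (pR ^ k)))%E.
Proof.
move=> c0; have mD := measurable_padic_disc x (pX_gt0 k).
under eq_integral do rewrite EFinM.
rewrite ge0_integralZl_EFin //; last by apply/measurable_EFinP; exact: measurable_indic.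
congr (_ * _)%E.
transitivity (nu (padic_disc x (pR ^ k) `&` setT)); first exact: integral_indic.
by rewrite setIT.
Qed.

Let integral_radial_transform_le K x :
  (\int[nu]_y (a K (x - (y : Qp)))%:E <= (mass_partial K)%:E)%E.
Proof.
pose f (i : 'I_K) (y : Qp_borel R p_pr) : \bar R :=
  ((w (b + i%:Z) * pR ^ (b + i%:Z) * \1_(padic_disc x (pR ^ (- (b + i%:Z)))) y)%:E +
   (w (b - 1 - i%:Z) * pR ^ (b - 1 - i%:Z) * \1_(padic_disc x (pR ^ (- (b - 1 - i%:Z)))) y)%:E)%E.
have E (y : Qp_borel R p_pr) : (a K (x - (y : Qp)))%:E = (\sum_(i < K) f i y)%E.
  by rewrite /radial_transform -sumEFin; apply: eq_bigr => i _; rewrite EFinD !indic_diff.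
have c0 k : 0 <= w k * pR ^ k by rewrite mulr_ge0 ?heat_weight_ge0 // ltW.
have t0 k l (y : Qp_borel R p_pr) : (0 <= (w k * pR ^ k * \1_(padic_disc x (pR ^ l)) y)%:E)%E.
  by rewrite lee_fin mulr_ge0 ?c0 // indicE ler0n.
have mt k l : measurable_fun setT
    (fun y : Qp_borel R p_pr => (w k * pR ^ k * \1_(padic_disc x (pR ^ l)) y)%:E).
  apply/measurable_EFinP; apply: measurable_funM => //.
  exact: (measurable_indic (measurable_padic_disc x (pX_gt0 l))).
under eq_integral do rewrite E.
rewrite ge0_integral_sum //; last 2 first.
- by move=> i; apply: emeasurable_funD; exact: mt.
- by move=> i y _; rewrite adde_ge0.
apply: (@le_trans _ _ (\sum_(i < K) ((w (b + i%:Z))%:E + (w (b - 1 - i%:Z) * pR ^- i.+1)%:E))%E).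
  apply: lee_sum => i _; rewrite ge0_integralD //.
  rewrite !integral_indic_disc //; apply: leeD.
    apply: le_trans (lee_wpmul2l _ (haar_ball_disc_le _ _)) _; first by rewrite lee_fin.
    by rewrite -EFinM lee_fin -mulrA -expfzDr ?gt_eqF // subrr expr0z mulr1.
  apply: (@le_trans _ _ ((w (b - 1 - i%:Z) * pR ^ (b - 1 - i%:Z))%:E * nu setT)%E).
    by apply: lee_wpmul2l; [rewrite lee_fin|apply: le_measure; rewrite ?inE //; exact: measurable_padic_disc].
  rewrite haar_ball_setT -EFinM lee_fin prime_exprz_lower // -mulrA.
  rewrite mulrAC -expfzDr ?gt_eqF // addNr expr0z mul1r.
  exact: lexx.
under eq_bigr do rewrite -EFinD.
rewrite sumEFin lee_fin big_split /= heat_upper_sum // lerD2r.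
by rewrite gerBl heat_profile_ge0.
Qed.

Let measurable_radial_transform_diff K x :
  measurable_fun setT (fun y : Qp_borel R p_pr => a K (x - (y : Qp))).
Proof.
apply: measurable_sum => i.
under eq_fun do rewrite !indic_diff.
apply: measurable_funD; apply: measurable_funM => //;
  exact: (measurable_indic (measurable_padic_disc x (pX_gt0 _))).
Qed.

Lemma measurable_heat_kernel_section x :
  measurable_fun setT (fun y : Qp_borel R p_pr => (Z (x - (y : Qp)))%:E).
Proof.
apply/measurable_EFinP.
apply: (measurable_fun_cvg (measurable_radial_transform_diff ^~ x)) => y _.
exact: (@heat_kernel_cvg (x - (y : Qp))).
Qed.

Lemma integral_heat_kernel_le x :
  (\int[nu]_y (Z (x - (y : Qp)))%:E <= ((1 - pR^-1) * S)%:E)%E.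
Proof.
have E : (fun y : Qp_borel R p_pr => (Z (x - (y : Qp)))%:E) =
    (fun y : Qp_borel R p_pr => limn (fun K => (a K (x - (y : Qp)))%:E)).
  apply/funext => y; apply/esym/cvg_lim => //; apply: cvg_EFin; first exact: nearW.
  exact: (@heat_kernel_cvg (x - (y : Qp))).
have a0 K (y : Qp_borel R p_pr) : (0 <= (a K (x - (y : Qp)))%:E)%E.
  by rewrite lee_fin; exact: radial_transform_ge0.
have and_ (y : Qp_borel R p_pr) m n : (m <= n)%N -> ((a m (x - (y : Qp)))%:E <= (a n (x - (y : Qp)))%:E)%E.
  by move=> mn; rewrite lee_fin; exact: (radial_transform_nd b psi_noninc).
have ma K : measurable_fun setT (fun y : Qp_borel R p_pr => (a K (x - (y : Qp)))%:E).
  by apply/measurable_EFinP; exact: measurable_radial_transform_diff.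
rewrite E monotone_convergence //; last by move=> y _ m n; exact: and_.
apply: lime_le.
  apply: ereal_nondecreasing_is_cvgn => m n mn; apply: ge0_le_integral => //.
  by move=> y _; exact: and_.
apply: nearW => K; apply: le_trans (integral_radial_transform_le K x) _.
by rewrite lee_fin.
Qed.

End ball_kernel.

#[local] Opaque heat_kernel cN.

Lemma eq_integral_ae d (X : measurableType d) (R : realType)
    (nu : {measure set X -> \bar R}) (P : set X) (f g : X -> R) :
  {ae nu, forall x, P x} -> measurable_fun setT f -> measurable_fun setT g ->
  (forall x, P x -> f x = g x) ->
  (\int[nu]_x (f x)%:E = \int[nu]_x (g x)%:E)%E.
Proof.
move=> aeP mf mg fg; apply: ae_eq_integral => //; [exact/measurable_EFinP..|].
by apply: filterS aeP => x Px _; rewrite fg.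
Qed.

(** * The semigroup on the ball *)

Section ball_semigroup_theory.
Context (R : realType) (p : nat) (p_pr : prime p).
Local Notation Qp := (Qp p_pr).
Local Notation U := (Qp_borel R p_pr).
Local Notation pR := (p%:R : R).
Local Notation ball := (@padic_ball R p p_pr).
Context (mu : {measure set U -> \bar R}).
Hypothesis mu_haar : normalized_haar mu.
Variables (N : int) (alpha : R).
Hypothesis alpha_gt0 : 0 < alpha.
Implicit Types (x y : Qp).

Local Notation nu := (haar_ball mu N).

Let p_gt0 : 0 < pR := prime_gt0r R p_pr.
Let p_gt1 : 1 < pR := prime_gt1r R p_pr.

Let nuT_lty : (nu setT < +oo)%E. Proof. by rewrite haar_ball_setT // ltry. Qed.

Let muB_lty : (mu (ball N) < +oo)%E.
Proof. by have := nuT_lty; rewrite /haar_ball /mrestr setTI. Qed.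

Let nuF : {finite_measure set U -> \bar R} :=
  mfrestr (@measurable_padic_ball R p p_pr N) muB_lty.

Lemma ae_haar_ball : {ae nu, forall x, ball N x}.
Proof.
have mB : measurable (ball N : set U) by exact: measurable_padic_ball.
exists (~` ball N : set U); split; [exact: measurableC| |by []].
by rewrite /haar_ball /mrestr setICl measure0.
Qed.

Lemma lambdaN_ge0 : 0 <= lambdaN p N alpha.
Proof.
rewrite mulr_ge0 ?powR_ge0 // divr_ge0 ?subr_ge0 ?(ltW p_gt1) //.
rewrite -[leLHS](powRr0 pR); apply: ler_powR; first exact: ltW.
by rewrite addr_ge0 // ltW.
Qed.

Section fixed_time.
Variables (t : R) (t_gt0 : 0 < t).
Local Notation G := (ball_heat_kernel mu N alpha t).
Local Notation T := (ball_semigroup mu N alpha t).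

Let G_diff (z : U * U) : R := G ((z.1 : Qp) - z.2).

Let G_bounded : exists C : R, forall x, `|G x| <= C.
Proof.
have [M HM] := heat_kernel_bounded mu_haar N alpha_gt0 t_gt0.
exists (expR (lambdaN p N alpha * t) * M + `|cN p N alpha t|) => x.
have /andP[Z0 ZM] := HM x; apply: le_trans (ler_normD _ _) _; rewrite lerD2r.
by rewrite ger0_norm ?mulr_ge0 ?expR_ge0 // ler_wpM2l ?expR_ge0.
Qed.

Let measurable_G_diff : measurable_fun setT G_diff.
Proof.
apply: measurable_funD => //; apply: measurable_funM => //.
exact: (measurable_heat_kernel_diff mu_haar N alpha_gt0 t_gt0).
Qed.

Let TE (v : Qp -> R) : T v = (fun x => \int[nu]_y (G_diff (x, y) * v y))%R.
Proof. by apply/funext => x; rewrite /ball_semigroup gt_eqF. Qed.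

Lemma integrable_ball_semigroup (v : Qp -> R) :
  nu.-integrable setT (EFin \o v) -> nu.-integrable setT (EFin \o T v).
Proof.
move=> vi; have [C HC] := G_bounded.
have := @integrable_kernel_op _ U R nuF G_diff C measurable_G_diff (fun x y => HC _) v vi.
by rewrite TE.
Qed.

(** [kernel_accretive] asks for sign and mass conditions at all points of $\mathbb Q_p$, whereas
    positivity is available on $B_N$. The cut-off is invisible to [haar_ball]. *)
Let k (z : U * U) : R := \1_(ball N) z.1 * \1_(ball N) z.2 * G_diff z.

Let measurable_k : measurable_fun setT k.
Proof.
have mB : measurable_fun setT (\1_(ball N) : U -> R).
  exact: (measurable_indic (@measurable_padic_ball R p p_pr N)).
apply: measurable_funM measurable_G_diff; apply: measurable_funM.
  exact: (measurableT_comp mB measurable_fst).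
exact: (measurableT_comp mB measurable_snd).
Qed.

Let measurable_k_section (x : U) : measurable_fun setT (fun y : U => k (x, y)).
Proof. exact: (measurableT_comp measurable_k (measurable_pair1 x)). Qed.

Let measurable_G_section (x : U) : measurable_fun setT (fun y : U => G_diff (x, y)).
Proof. exact: (measurableT_comp measurable_G_diff (measurable_pair1 x)). Qed.

Let ball_diff x y : ball N x -> ball N y -> ball N (x - y).
Proof. exact: padic_absB_le. Qed.

Let k_ge0 (x y : U) : 0 <= k (x, y).
Proof.
rewrite /k /= !indicE; have [/set_mem xN|_] := boolP (x \in _); last by rewrite !mul0r.
have [/set_mem yN|_] := boolP (y \in _); last by rewrite mulr0 mul0r.
by rewrite !mul1r; exact: (ball_heat_kernel_ge0 mu_haar alpha_gt0 t_gt0 (ball_diff xN yN)).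
Qed.

Let k_le (x y : U) : `|k (x, y)| <= `|G ((x : Qp) - y)|.
Proof.
rewrite /k /= normrM -[leRHS]mul1r; apply: ler_wpM2r => //.
by rewrite !indicE; do 2 case: (_ \in _); rewrite ?mul0r ?mulr0 ?mulr1 ?normr0 ?normr1.
Qed.

Let GN (z : Qp) : G (- z) = G z.
Proof. by rewrite /ball_heat_kernel (heat_kernelN mu_haar N alpha_gt0 t_gt0). Qed.

Let k_sym (x y : U) : k (x, y) = k (y, x).
Proof.
have Gs : G_diff (x, y) = G_diff (y, x).
  exact: esym (etrans (congr1 G (esym (opprB (x : Qp) y))) (GN ((x : Qp) - y))).
exact: (congr2 *%R (mulrC (\1_(ball N) x) (\1_(ball N) y)) Gs).
Qed.

(** The constant $c(t)$ is integrated over mass $p^N$: its term in $S$ cancels the bound for the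
    heat kernel part, and $p^{-N} p^N = 1$ is left. *)
Let integral_ball_heat_kernel_le x : (\int[nu]_y (G (x - (y : Qp)))%:E <= 1)%E.
Proof.
set e := expR (lambdaN p N alpha * t); set c := cN p N alpha t.
have e0 : 0 <= e by exact: expR_ge0.
have mZ := measurable_heat_kernel_section mu_haar N alpha_gt0 t_gt0 x.
have [M HM] := heat_kernel_bounded mu_haar N alpha_gt0 t_gt0.
have Zi : nu.-integrable setT (fun y : U => (heat_kernel mu alpha t (x - (y : Qp)))%:E).
  apply: (@measurable_bounded_integrable _ U R nu).
  - exact: measurableT.
  - exact: nuT_lty.
  - exact/measurable_EFinP.
  exists M; split=> [|K]; first exact: num_real.
  move=> MK y _; have /andP[Z0 ZM] := HM (x - (y : Qp)).
  by rewrite /= ger0_norm // (le_trans ZM) // ltW.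
have ci : nu.-integrable setT (EFin \o (cst c : U -> R)).
  exact: (finite_measure_integrable_cst nuF).
have -> : (\int[nu]_y (G (x - (y : Qp)))%:E =
    e%:E * \int[nu]_y (heat_kernel mu alpha t (x - (y : Qp)))%:E + c%:E * (pR ^ N)%:E)%E.
  transitivity (\int[nu]_y (e%:E * (heat_kernel mu alpha t (x - (y : Qp)))%:E +
    (EFin \o (cst c : U -> R)) y))%E; first by apply: eq_integral.
  rewrite (integralD measurableT (integrableZl measurableT e Zi) ci).
  rewrite (integralZl measurableT Zi); congr (_ + _)%E.
  exact: etrans (integral_cst nu measurableT c%:E) (congr1 _ (haar_ball_setT mu_haar N)).
apply: (@le_trans _ _ (e%:E * ((1 - pR^-1) * gexp pR (heat_ratio p alpha) (heat_scale p alpha t (- N)))%:E +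
    c%:E * (pR ^ N)%:E)%E).
  rewrite leeD2r // lee_wpmul2l ?lee_fin //.
  exact: (integral_heat_kernel_le mu_haar N alpha_gt0 t_gt0 x).
rewrite -!EFinM -EFinD lee_fin /c cNE // -/e.
have pN : pR ^ (- N) * pR ^ N = 1 by rewrite -expfzDr ?gt_eqF // addNr expr0z.
move: (gexp _ _ _) pN => S; move: (pR ^ (- N)) (pR ^ N) (pR^-1) => u v r uv.
have -> : e * ((1 - r) * S) + (u - u * (1 - r) * e * S) * v =
  e * ((1 - r) * S) * (1 - u * v) + u * v by ring.
by rewrite uv subrr mulr0 add0r.
Qed.

Let k_mass (x : U) : (\int[nu]_y (k (x, y))%:E <= 1)%E.
Proof.
have [xN|xN] := boolP (x \in (ball N : set U)); last first.
  by under eq_integral do rewrite /k /= indicE (negbTE xN) !mul0r; rewrite integral0 lee_fin.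
rewrite (_ : \int[nu]_y _ = \int[nu]_y (G ((x : Qp) - (y : Qp)))%:E)%E.
  exact: integral_ball_heat_kernel_le.
apply: (eq_integral_ae ae_haar_ball (measurable_k_section x) (measurable_G_section x)).
by move=> y yN; rewrite /k /= !indicE xN mem_set // !mul1r.
Qed.

Lemma ball_semigroup_accretive (q v : Qp -> R) (L : R) :
  measurable_fun setT (q : U -> R) -> (forall x, `|q x| <= L) ->
  nu.-integrable setT (EFin \o v) ->
  (forall x, 0 <= q x * v x) ->
  (forall x y, 0 <= (q x - q y) * (v x - v y)) ->
  (\int[nu]_x (q x * T v x)%:E <= \int[nu]_x (q x * v x)%:E)%E.
Proof.
move=> mq qL vi qv qvm; have [C HC] := G_bounded.
have kC (x y : U) : `|k (x, y)| <= C by apply: le_trans (k_le x y) _; exact: HC.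
have := @kernel_accretive _ U R nuF k C measurable_k kC k_ge0 k_sym k_mass q v L mq qL vi qv qvm.
apply: le_trans; rewrite le_eqVlt; apply/orP; left; apply/eqP.
have mv : measurable_fun setT (v : U -> R) by apply/measurable_EFinP; exact: measurable_int vi.
have mT : measurable_fun setT (T v : U -> R).
  by apply/measurable_EFinP; exact: measurable_int (integrable_ball_semigroup vi).
have mK : measurable_fun setT (fun x : U => \int[nuF]_y (k (x, y) * v y))%R.
  apply/measurable_EFinP.
  exact: measurable_int (@integrable_kernel_op _ U R nuF k C measurable_k kC v vi).
apply: (eq_integral_ae ae_haar_ball (measurable_funM mq mT) (measurable_funM mq mK)).
move=> x xN; rewrite TE; congr (_ * _); congr fine.
apply: (eq_integral_ae ae_haar_ball (measurable_funM (measurable_G_section x) mv)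
  (measurable_funM (measurable_k_section x) mv)).
by move=> y yN; rewrite /k /= !indicE !mem_set // !mul1r.
Qed.

End fixed_time.

End ball_semigroup_theory.

(** * Accretivity of the nonlinear operator *)

(** The integral of $q\,(v - T_t v)/t$ is nonnegative and exceeds that of $q g$ by at most $L$ times
    the $L^1$ norm that tends to 0. Boundedness of [q] is what makes $L^1$ convergence enough. *)
Lemma accretive_limit d (X : measurableType d) (R : realType)
    (nu : {measure set X -> \bar R}) (q v g : X -> R) (T : R -> X -> R) (L : R) :
  measurable_fun setT q -> (forall x, `|q x| <= L) ->
  nu.-integrable setT (EFin \o v) -> nu.-integrable setT (EFin \o g) ->
  (forall t, 0 < t -> nu.-integrable setT (EFin \o T t)) ->
  (forall t, 0 < t ->
    (\int[nu]_x (q x * T t x)%:E <= \int[nu]_x (q x * v x)%:E)%E) ->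
  L1norm nu (fun x => (v x - T t x) / t - g x) @[t --> 0^'+] --> 0%E ->
  (0 <= \int[nu]_x (q x * g x)%:E)%E.
Proof.
move=> mq qL vi gi Ti Tle Dcvg.
have qi f : nu.-integrable setT (EFin \o f) ->
    nu.-integrable setT (fun x => (q x * f x)%:E).
  move=> fi; have mf : measurable_fun setT f by apply/measurable_EFinP/(measurable_int nu).
  apply: (le_integrable measurableT _ _ (integrableZl measurableT L fi)).
    by apply/measurable_EFinP; apply: measurable_funM.
  move=> x _; rewrite -EFinM lee_fin !normrM ler_wpM2r //.
  by rewrite (ger0_norm (le_trans _ (qL x))).
have Ifin : (\int[nu]_x (q x * g x)%:E)%E \is a fin_num.
  by apply: integrable_fin_num => //; exact: qi.
set F := (fun t : R => _) in Dcvg.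
have C : ((\int[nu]_x (q x * g x)%:E + L%:E * F t)%E @[t --> 0^'+] -->
    (\int[nu]_x (q x * g x)%:E + L%:E * 0)%E).
  by apply: cvgeD; [rewrite fin_num_adde_defr|exact: cvg_cst|exact: cvgeZl].
have -> : (\int[nu]_x (q x * g x)%:E = \int[nu]_x (q x * g x)%:E + L%:E * 0)%E.
  by rewrite mule0 adde0.
rewrite -(cvg_lim _ C) //; apply: lime_ge; first exact: cvgP C.
near=> t; have t0 : 0 < t by near: t; exact: nbhs_right_gt.
pose D x := (v x - T t x) / t - g x.
have Di : nu.-integrable setT (EFin \o D).
  have := integrableB measurableT (integrableZl measurableT t^-1
    (integrableB measurableT vi (Ti t t0))) gi.
  by apply: eq_integrable => // x _; rewrite /D /= mulrC EFinB EFinM EFinB.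
rewrite /F L1normE -integralZl //; last exact: integrable_norm.
rewrite -integralD //; [|exact: qi|apply: integrableZl => //; exact: integrable_norm].
apply: (@le_trans _ _ (\int[nu]_x (t^-1%:E * ((q x * v x)%:E - (q x * T t x)%:E)))%E).
  rewrite integralZl //; last by apply: integrableB => //; apply: qi => //; exact: Ti.
  rewrite integralB //; [|exact: qi|exact: qi (Ti _ t0)].
  by rewrite mule_ge0 ?lee_fin ?invr_ge0 ?(ltW t0) // sube_ge0 ?Tle //
    integrable_fin_num // ?qi // Ti.
apply: le_integral => //.
- apply: integrableZl => //; apply: integrableB => //; apply: qi => //; exact: Ti.
- apply: integrableD => //; first exact: qi.
  by apply: integrableZl => //; exact: integrable_norm.
move=> x _; rewrite -EFinB -!EFinM -EFinD lee_fin.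
have : q x * D x <= L * `|D x|.
  by apply: le_trans (ler_norm _) _; rewrite normrM ler_wpM2r.
rewrite /D; set a := _ / t; have -> : t^-1 * (q x * v x - q x * T t x) = q x * a.
  by rewrite /a; ring.
lra.
Unshelve. all: by end_near. Qed.

Section nonlinear_accretivity.
Context (R : realType) (p : nat) (p_pr : prime p).
Local Notation Qp := (Qp p_pr).
Local Notation U := (Qp_borel R p_pr).
Context (mu : {measure set U -> \bar R}).
Hypothesis mu_haar : normalized_haar mu.
Variables (N : int) (alpha : R).
Hypothesis alpha_gt0 : 0 < alpha.
Variable Phi : R -> R.
Hypothesis Phi_incr : {homo Phi : x y / x < y}.
Hypothesis Phi0 : Phi 0 = 0.
Variables (j q : R -> R) (L : R).
Hypothesis jq : entropy_pair j q L.

Let slope_Phi_mono a b : 0 <= (q a - q b) * (Phi a - Phi b).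
Proof.
have := entropy_slope_mono jq a b.
have [ab|ab|->] := ltgtP a b; last by rewrite !subrr mulr0.
  by rewrite nmulr_lge0 ?subr_lt0 // nmulr_lge0 ?subr_lt0 ?Phi_incr.
by rewrite pmulr_lge0 ?subr_gt0 // pmulr_lge0 ?subr_gt0 ?Phi_incr.
Qed.

Let slope_Phi_ge0 a : 0 <= q a * Phi a.
Proof.
have := entropy_slope_ge0 jq a.
have [a0|a0|->] := ltgtP a 0; last by rewrite Phi0 !mulr0.
  by have := Phi_incr a0; rewrite Phi0 => P0; rewrite !nmulr_lge0.
by have := Phi_incr a0; rewrite Phi0 => P0; rewrite !pmulr_lge0.
Qed.

(** Write $g = g_0 + \lambda\,\Phi(z)$ with $g_0 = A_N \Phi(z)$. The first part is accretive as a
    limit of difference quotients of the semigroup; the second has integrand $\lambda\,q(z)\Phi(z)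
    \ge 0$, as $\lambda \ge 0$ and $q$, $\Phi$ both have the sign of their argument where
    nonzero. *)
Lemma DN_comp_accretive (z g : Qp -> R) :
  z \in Lfun (haar_ball mu N) 1 -> DN_comp mu N alpha Phi z g ->
  (haar_ball mu N).-integrable setT (EFin \o g) /\
  (0 <= \int[haar_ball mu N]_x (q (z x) * g x)%:E)%E.
Proof.
move=> zL [_ [vL gL Dcvg]].
set nu := haar_ball mu N; set lam := lambdaN p N alpha in gL Dcvg.
pose v := Phi \o z; pose g0 x := g x - lam * v x.
have /Lfun1_integrable zi := zL.
have /Lfun1_integrable vi : v \in Lfun nu 1 := vL.
have /Lfun1_integrable g0i : g0 \in Lfun nu 1 := gL.
have mz : measurable_fun setT (z : U -> R) by apply/measurable_EFinP; exact: measurable_int zi.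
have gE x : g x = g0 x + lam * v x by exact: esym (subrK _ _).
have gi : nu.-integrable setT (EFin \o g).
  have := integrableD measurableT g0i (integrableZl measurableT lam vi).
  by apply: eq_integrable => // x _; rewrite /= gE.
split=> //.
have mq : measurable_fun setT (q \o z : U -> R).
  exact: measurableT_comp (entropy_slope_measurable jq) mz.
have Qg0 : (0 <= \int[nu]_x (q (z x) * g0 x)%:E)%E.
  have Ti t : 0 < t -> nu.-integrable setT (EFin \o ball_semigroup mu N alpha t v).
    by move=> t0; exact: (integrable_ball_semigroup mu_haar alpha_gt0 t0 vi).
  have qL (x : U) : `|(q \o z) x| <= L by exact: (entropy_slope_bound jq).
  apply: (accretive_limit mq qL vi g0i Ti _ Dcvg) => t t0.
  apply: (ball_semigroup_accretive mu_haar alpha_gt0 t0 mq qL vi).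
  - by move=> x; exact: slope_Phi_ge0.
  - by move=> x y; exact: slope_Phi_mono.
have Qv : (0 <= \int[nu]_x (q (z x) * (lam * v x))%:E)%E.
  apply: integral_ge0 => x _; rewrite lee_fin mulrCA.
  exact: mulr_ge0 (lambdaN_ge0 _ _ alpha_gt0) (slope_Phi_ge0 _).
under eq_integral do rewrite gE mulrDr EFinD.
rewrite integralD //; [exact: adde_ge0|exact: (integrable_slope_mul jq mz g0i)|].
exact: (integrable_slope_mul jq mz (integrableZl measurableT lam vi)).
Qed.

End nonlinear_accretivity.

Theorem theorem4 (R : realType) (p : nat) (p_pr : prime p)
    (mu : {measure set (Qp_borel R p_pr) -> \bar R})
    (mu_haar : normalized_haar mu)
    (N : int) (alpha : R) (alpha_gt0 : 0 < alpha)
    (Phi : R -> R) (Phi_incr : {homo Phi : x y / x < y})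
    (Phi_cont : continuous Phi) (Phi0 : Phi 0 = 0)
    (gamma : \bar R) (gamma_ge1 : (1 <= gamma)%E)
    (u0 : Qp p_pr -> R) (u0_Lgamma : u0 \in Lfun (haar_ball mu N) gamma)
    (u0_gt0 : {ae haar_ball mu N, forall x, 0 < u0 x})
    (u : R -> Qp p_pr -> R)
    (u_mild : mild_solution (haar_ball mu N) (DN_comp mu N alpha Phi) u0 u) :
  forall t : R, 0 < t ->
    u t \in Lfun (haar_ball mu N) gamma /\
    ('N[haar_ball mu N]_gamma[EFin \o u t] <=
     'N[haar_ball mu N]_gamma[EFin \o u0])%E.
Proof.
move=> t t_gt0.
have mut : measurable_fun setT (u t : Qp_borel R p_pr -> R).
  have /Lfun1_integrable/measurable_int ui := mild_L1 u_mild (ltW t_gt0).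
  exact/measurable_EFinP.
have mu0 : measurable_fun setT (u0 : Qp_borel R p_pr -> R).
  by have := sub_Lfun_mfun u0_Lgamma; rewrite inE.
apply: (Lfun_le_entropy gamma_ge1 mut u0_Lgamma) => j q L jq.
apply: (mild_solution_entropy jq _ mu0 u_mild t_gt0) => z g zL.
exact: (DN_comp_accretive mu_haar alpha_gt0 Phi_incr Phi0 jq zL).
Qed.
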